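(* There is an absolute constant $c>0$ such that the following holds. Let $F$ be a field of odd positive characteristic $p$, and let $A\subset F_*=F\setminus\{0\}$ be a finite set with $|A|>1$ and $|A|<p^{5/8}$. Then $$|A+A|+|1/A+1/A|\ \ge\ c\,|A|^{16/15}\qquad\text{and}\qquad |A+A^{-1}|\ \ge\ c\,|A|^{31/30}.$$
   Context: $1/A=A^{-1}=\{a^{-1}: a\in A\}$, and $X+Y=\{x+y: x\in X,y\in Y\}$ for $X,Y\subset F$. *)

(* Defs.v *)
From mathcomp Require Import all_boot all_order all_algebra.
From mathcomp Require Import finmap.
From mathcomp Require Import reals exp.

Set Implicit Arguments.
Unset Strict Implicit.
Unset Printing Implicit Defensive.

Import Order.TTheory GRing.Theory Num.Theory.

Local Open Scope fset_scope.
Local Open Scope ring_scope.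

Definition sumset (F : fieldType) (X Y : {fset F}) : {fset F} :=
  [fset x + y | x in X, y in Y].

(* 0^-1 = 0 in MathComp: this is the usual A^{-1} when 0 \notin A. *)
Definition invset (F : fieldType) (A : {fset F}) : {fset F} :=
  [fset a^-1 | a in A].

(* Main.v *)
Require Import Defs.
From mathcomp Require Import all_boot all_order all_algebra.
From mathcomp Require Import mpoly.
From mathcomp Require Import finmap.
From mathcomp Require Import reals exp.
From mathcomp Require Import ring lra zify.

Import Order.TTheory GRing.Theory Num.Theory.
Local Open Scope ring_scope.

(** The engine is a bound for the number of lines that are rich in points of a
    grid [U * V].  A pair (line, abscissa) is encoded as a line of [K^3] of
    direction [(1, - a, a ^ 2)] (a "ray"), in such a way that the coincidence
    [l x = l' y] means that two rays meet.  Suppose that every ray meets many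
    others, and let [f] be a nonzero polynomial of least degree vanishing on all
    of them; this degree is below [p].  At a point of a ray the gradient of [f],
    applied to the directions [(1, - t, t ^ 2)], is a quadratic polynomial in
    [t], so besides the direction [a] of the ray there is a single cross direction
    [t = a + u].  Counting zeros, [f] vanishes to second order in the cross
    direction along the whole ray.  Differentiating this condition along the
    crossing rays gives [(1 / u)'' = 0], so that [1 / u] is affine because all
    degrees are less than [p]: the crossing rays lie in a regulus, that is, they
    come from collinear points.  Few of the pairs (line, abscissa) are collinear,
    a contradiction.

    If [A + A] and [1/A + 1/A] have at most [n] elements, with [N = |A|], one fixes
    [t1, t2] in [1/A + 1/A] such that many pairs [(a, a')] have [t1 - 1/a] and
    [t2 - 1/a'] in [1/A] and a popular sum [s = a + a'].  For [b + b' = s] the point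
    with coordinates [1 / (1/b - 1/a)] and [1 / (1/b' - 1/a')] lies on a line which
    depends on [(a, a')] only.  This gives many lines that are rich in a grid, and
    finally [N ^ 12 <= C * n ^ 11].  The second inequality is obtained in the same
    way from [A] and [- A], using Ruzsa's triangle inequality to bound [A - A]. *)

Set Implicit Arguments.
Unset Strict Implicit.
Unset Printing Implicit Defensive.

(** * Restriction of polynomials to rays *)

(** The chain rule: the polynomials [f] that satisfy it include constants and variables and are
    closed under sums and products. *)
Lemma deriv_mmap (n : nat) (K : comNzRingType) (h : 'I_n -> {poly K})
    (f : {mpoly K[n]}) :
  (mmap polyC h f)^`() = \sum_(i < n) (h i)^`() * mmap polyC h f^`M(i).
Proof.
pose P f := (mmap polyC h f)^`() = \sum_(i < n) (h i)^`() * mmap polyC h f^`M(i).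
have PC c : P c%:MP.
  rewrite /P mmapC derivC big1 // => i _.
  by rewrite mderivC mmap0 mulr0.
have PD f1 f2 : P f1 -> P f2 -> P (f1 + f2).
  rewrite /P mmapD derivD => -> ->; rewrite -big_split /=.
  by apply: eq_bigr => i _; rewrite mderivD mmapD mulrDr.
have PM f1 f2 : P f1 -> P f2 -> P (f1 * f2).
  rewrite /P rmorphM /= derivM => -> ->.
  rewrite mulr_suml mulr_sumr -big_split /=.
  apply: eq_bigr => i _; rewrite mderivM mmapD !rmorphM /=; ring.
have PX i : P 'X_i.
  rewrite /P mmapX mmap1U (bigD1 i) //= big1 ?addr0.
    rewrite mderivX mnm1E eqxx scale1r.
    have -> : (U_(i) - U_(i))%MM = 0%MM :> 'X_{1..n} by apply/mnmP => j; rewrite !mnmE subnn.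
    by rewrite mpolyX0 rmorph1 mulr1.
  move=> j ji; rewrite mderivX mnm1E eq_sym (negbTE ji) scale0r mmap0.
  by rewrite mulr0.
have P1 : P 1 by rewrite -mpolyC1.
have PXm m : P 'X_[m].
  rewrite mpolyXE_id; elim/big_ind: _ => // i _.
  by elim: (m i) => [|k IH]; rewrite ?expr0 // exprS; apply: PM.
rewrite -/(P f); elim/mpolyind: f => [|c m f _ _ Pf]; first by rewrite -mpolyC0.
by rewrite -mul_mpolyC; apply: PD => //; apply: PM.
Qed.

Lemma size_mmap (n : nat) (K : idomainType) (h : 'I_n -> {poly K})
    (f : {mpoly K[n]}) :
  (forall i, size (h i) <= 2)%N -> (size (mmap polyC h f) <= msize f)%N.
Proof.
move=> h2; rewrite /mmap.
apply: (leq_trans (size_sum _ _ _)).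
rewrite big_seq; elim/big_ind: _ => [//|x y xf yf|m mf]; first by rewrite geq_max xf yf.
rewrite mul_polyC (leq_trans (size_scale_leq _ _)) //.
apply: leq_trans (msize_mdeg_lt mf).
rewrite /mmap1 (leq_trans (size_poly_prod_leq _ _)) //.
rewrite leq_subLR (leq_trans (n := (\sum_(i < n) (m i).+1).+1)) //.
  rewrite ltnS; apply: leq_sum => i _.
  rewrite (leq_trans (size_poly_exp_leq _ _)) // ltnS.
  by rewrite -[leqRHS]mul1n leq_mul2r -subn1 leq_subLR h2 orbT.
have -> : (\sum_(i < n) (m i).+1 = \sum_(i < n) m i + n)%N.
  rewrite (eq_bigr (fun i => m i + 1)%N) => [|i _]; last by rewrite addn1.
  by rewrite big_split /= sum1_card card_ord.
by rewrite mdegE card_ord addnC ltn_add2l ltnSn.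
Qed.

Lemma horner_mmap (n : nat) (K : comNzRingType) (h : 'I_n -> {poly K})
    (f : {mpoly K[n]}) (x : K) :
  (mmap polyC h f).[x] = f.@[fun i => (h i).[x]].
Proof.
rewrite /mmap horner_sum mevalE; apply: eq_bigr => m _.
rewrite hornerM hornerC; congr (_ * _); rewrite /mmap1 horner_prod.
by apply: eq_bigr => i _; rewrite horner_exp.
Qed.

(** Size at most [p] means degree below [p], so a positive exponent in the support is nonzero in [K]
    and its monomial survives in a partial derivative. *)
Lemma mpoly_deriv_eq0 (n p : nat) (K : fieldType) (f : {mpoly K[n]}) :
  p \in [pchar K] -> (msize f <= p)%N -> (forall i, f^`M(i) = 0) ->
  f = (f@_0)%:MP.
Proof.
move=> charp fp df; apply: msize1_polyC; rewrite msizeE.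
rewrite big_seq; elim/big_ind: _ => [//|x y xf yf|m mf].
  by rewrite geq_max xf yf.
rewrite ltnS leqn0 mdeg_eq0; apply/eqP/mnmP => i; rewrite mnm0E.
apply/eqP; rewrite -leqn0 leqNgt; apply/negP => mi.
have := congr1 (mcoeff (m - U_(i))%MM) (df i).
have leUm : (U_(i) <= m)%MM by rewrite lep1mP -lt0n.
rewrite mcoeff_deriv mcoeff0 submK // mnmBE mnm1E eqxx subn1 prednK //.
move/eqP; rewrite -mulr_natr mulf_eq0 => /orP[|].
  by move: mf; rewrite mcoeff_msupp => /negPf ->.
rewrite -(dvdn_pcharf charp) => /dvdn_leq; rewrite mi => /(_ isT) pm.
have := msize_mdeg_lt mf; rewrite ltnNge; move/negP; apply.
apply: (leq_trans fp); apply: (leq_trans pm).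
by rewrite mdegE (bigD1 i) //= leq_addr.
Qed.

Local Notation ix0 := (inord 0 : 'I_3).
Local Notation ix1 := (inord 1 : 'I_3).
Local Notation ix2 := (inord 2 : 'I_3).

Section Ray.
Variable K : fieldType.
Implicit Types (r : K * K * K) (f : {mpoly K[3]}).

(* The ray [(a, b, c)] is the set of points [(x, b - a x, c - a b + a ^ 2 x)]. *)
Definition ray_point r : 'I_3 -> {poly K} := fun i =>
  nth 0 [:: 'X; r.1.2%:P - r.1.1 *: 'X;
            (r.2 - r.1.1 * r.1.2)%:P + r.1.1 ^+ 2 *: 'X] i.

Definition on_ray r f : {poly K} := mmap polyC (ray_point r) f.

Lemma deriv_on_ray r f : (on_ray r f)^`() =
  on_ray r f^`M(ix0) - r.1.1 *: on_ray r f^`M(ix1)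
  + r.1.1 ^+ 2 *: on_ray r f^`M(ix2).
Proof.
rewrite /on_ray deriv_mmap !big_ord_recl big_ord0 addr0.
have -> : lift ord0 (lift ord0 ord0) = ix2 :> 'I_3 by apply/val_inj; rewrite /= inordK.
have -> : lift ord0 ord0 = ix1 :> 'I_3 by apply/val_inj; rewrite /= inordK.
have -> : ord0 = ix0 :> 'I_3 by apply/val_inj; rewrite /= inordK.
have E1 (a b : K) : (b%:P - a *: 'X)^`() = - a%:P.
  by rewrite derivB derivC derivZ derivX sub0r alg_polyC.
have E2 (a b : K) : (b%:P + a *: 'X)^`() = a%:P.
  by rewrite derivD derivC derivZ derivX add0r alg_polyC.
rewrite {1 3 5}/ray_point !inordK //= E1 E2 derivX mul1r addrA.
by rewrite -!mul_polyC mulNr.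
Qed.

Lemma size_on_ray r f : (size (on_ray r f) <= msize f)%N.
Proof.
apply: size_mmap => i; rewrite /ray_point.
have sZX (a : K) : (size (a *: 'X : {poly K}) <= 2)%N.
  by rewrite (leq_trans (size_scale_leq _ _)) ?size_polyX.
have sC (b : K) : (size (b%:P : {poly K}) <= 2)%N.
  by rewrite size_polyC; case: eqP.
case: i => -[|[|[|//]]] /= _; first by rewrite size_polyX.
  by rewrite (leq_trans (size_polyD _ _)) // geq_max sC size_polyN sZX.
by rewrite (leq_trans (size_polyD _ _)) // geq_max sC sZX.
Qed.

Definition meet_at (x : K) r s :=
  [/\ r.1.1 != s.1.1, r.1.2 - r.1.1 * x = s.1.2 - s.1.1 * x
    & r.2 - r.1.1 * r.1.2 + r.1.1 ^+ 2 * x = s.2 - s.1.1 * s.1.2 + s.1.1 ^+ 2 * x].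

Lemma horner_on_ray_meet x r s f :
  meet_at x r s -> (on_ray r f).[x] = (on_ray s f).[x].
Proof.
case=> _ e1 e2; rewrite /on_ray !horner_mmap; apply: meval_eq => i.
rewrite /ray_point; case: i => -[|[|[|//]]] /= _; rewrite !hornerE //.
Qed.

Lemma deriv2_on_ray r f : on_ray r f = 0 ->
  on_ray r f^`M(ix0) = r.1.1 *: on_ray r f^`M(ix1) - r.1.1 ^+ 2 *: on_ray r f^`M(ix2).
Proof.
move=> f0; have := deriv_on_ray r f; rewrite f0 deriv0 => /esym/eqP.
by rewrite -addrA addr_eq0 opprD opprK => /eqP.
Qed.

(** Linear algebra: exponents below [D] give [D ^ 3] monomials of degree at most [3 * D - 3], and
    vanishing on one ray amounts to [3 * D - 2] linear conditions on the coefficients. *)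
Lemma exists_vanishing (I : finType) (r : I -> K * K * K) (D : nat) :
  (#|I| * (3 * D - 2) < D ^ 3)%N ->
  exists f : {mpoly K[3]}, [/\ f != 0, (msize f <= 3 * D - 2)%N
    & forall i, on_ray (r i) f = 0].
Proof.
move=> ltID; pose d := (3 * D - 2)%N; pose T := ('I_D * 'I_D * 'I_D)%type.
pose e (u : T) (k : 'I_3) : nat := nth 0%N [:: u.1.1 : nat; u.1.2 : nat; u.2 : nat] k.
pose mon (u : T) : 'X_{1..3} := [multinom e u k | k < 3].
have mon_inj : injective mon.
  move=> [[a b] c] [[a' b'] c'] /mnmP E.
  have := E ix0; have := E ix1; have := E ix2; rewrite !mnmE /e !inordK //=.
  by move=> /val_inj-> /val_inj-> /val_inj->.
have msize_mon u : (msize ('X_[mon u] : {mpoly K[3]}) <= d)%N.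
  rewrite msizeX mdegE !big_ord_recl big_ord0 !mnmE /e /=.
  by case: u => [[[a ?] [b ?]] [c ?]] /=; rewrite /d; lia.
pose M : 'M[K]_(#|{: T}|, #|{: I * 'I_d}|) :=
  \matrix_(u, ij) let v : I * 'I_d := enum_val ij in
    (on_ray (r v.1) 'X_[mon (enum_val u)])`_(v.2).
have /rowV0Pn[v /sub_kermxP vM v0] : kermx M != 0.
  rewrite -mxrank_eq0 mxrank_ker subn_eq0 -ltnNge.
  rewrite (leq_ltn_trans (rank_leq_col _)) // !card_prod !card_ord.
  by rewrite (leq_trans ltID) // !expnS expn0 muln1 mulnA.
pose f : {mpoly K[3]} := \sum_(u : T) v 0 (enum_rank u) *: 'X_[mon u].
have fE u : f@_(mon u) = v 0 (enum_rank u).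
  rewrite /f raddf_sum /= (bigD1 u) //= mcoeffZ mcoeffX eqxx mulr1 big1 ?addr0 //.
  by move=> u' /negPf u'u; rewrite mcoeffZ mcoeffX (inj_eq mon_inj) u'u mulr0.
have fd : (msize f <= d)%N.
  apply: (leq_trans (msize_sum _ _ _)); apply/bigmax_leqP => u _.
  by rewrite (leq_trans (msizeZ_le _ _)).
exists f; split=> // [|i].
  apply: contraNneq v0 => f0; apply/eqP/rowP => u.
  by rewrite mxE -[u]enum_valK -fE f0 mcoeff0.
apply/polyP => j; rewrite coef0; case: (ltnP j d) => [jd|dj]; last first.
  by rewrite nth_default // (leq_trans (size_on_ray _ _)) // (leq_trans fd).
have := congr1 (fun w : 'rV_ _ => w 0 (enum_rank (i, Ordinal jd))) vM.
rewrite !mxE => {2}<-; rewrite /on_ray /f raddf_sum coef_sum.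
rewrite (reindex (@enum_val T predT)) /=; last exact: onW_bij (@enum_val_bij T).
apply: eq_bigr => u _; rewrite mmapZ enum_valK coefCM.
by rewrite mxE enum_rankK.
Qed.

Lemma msize_mderiv_lt (f : {mpoly K[3]}) k :
  f^`M(k) != 0 -> (msize f^`M(k) < msize f)%N.
Proof.
move=> f'0; rewrite -ltnS.
have f0 : f != 0 by apply: contraNneq f'0 => ->; rewrite mderiv0.
have fpos : (0 < msize f)%N by rewrite lt0n msize_poly_eq0.
rewrite ltnS -[leqRHS]prednK // ltnS [leqLHS]msizeE big_seq.
elim/big_ind: _ => [//|x y xf yf|m]; first by rewrite geq_max xf yf.
rewrite mcoeff_msupp mcoeff_deriv -mulr_natr => /negPf mf.
rewrite -ltnS prednK //.
have -> : (mdeg m).+1 = mdeg (m + U_(k))%MM by rewrite mdegD mdeg1 addn1.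
apply: msize_mdeg_lt; rewrite mcoeff_msupp.
by apply/negP => /eqP m0; rewrite m0 mul0r eqxx in mf.
Qed.

End Ray.

(** * Contact along a ray *)

Section Contact.
Variable K : fieldType.
Implicit Types a c g h : K.

(** The gradient applied to [(1, - t, t ^ 2)] is [f0 - t * g + t ^ 2 * h]. It has the distinct roots
    [a] and [c], whose sum is given by Vieta. *)
Lemma cross_slope a c g h f0 : a != c ->
  f0 = c * g - c ^+ 2 * h -> f0 = a * g - a ^+ 2 * h -> g = (a + c) * h.
Proof.
move=> ac -> /eqP; rewrite -subr_eq0.
have -> : c * g - c ^+ 2 * h - (a * g - a ^+ 2 * h) = (c - a) * (g - (a + c) * h) by ring.
by rewrite mulf_eq0 !subr_eq0 [c == a]eq_sym (negPf ac) => /eqP.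
Qed.

(** Since [u = a * h], the vector [(h ^ 2, - u * h, u ^ 2)] is [h ^ 2] times the direction of the
    crossing ray. Written with [g], [h] and [c] instead of [a], the condition makes sense along the
    whole ray of direction [c]. *)
Lemma contact2 a c g h H00 H01 H02 H11 H12 H22 : g = (a + c) * h ->
  H00 - a * H01 + a ^+ 2 * H02 - a * (H01 - a * H11 + a ^+ 2 * H12)
    + a ^+ 2 * (H02 - a * H12 + a ^+ 2 * H22) = 0 ->
  let u := g - c * h in
  H00 * h ^+ 4 - 2 * H01 * (h ^+ 3 * u) + 2 * H02 * (h ^+ 2 * u ^+ 2)
  + H11 * (h ^+ 2 * u ^+ 2) - 2 * H12 * (h * u ^+ 3) + H22 * u ^+ 4 = 0.
Proof.
move=> -> E u; have -> : u = a * h by rewrite /u; ring.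
by rewrite -[RHS](mulr0 (h ^+ 4)) -[in RHS]E; ring.
Qed.

(* At the crossing of a ray of direction [c] with a ray of direction [a]: the
   suffixes [1], [2] denote derivatives along the first ray, [v] and the [K]s
   derivatives along the second one.  The last hypothesis is the derivative along
   the second ray of the second order contact condition; the conclusion is the
   numerator of [(h / e)'' = 0] along the first ray, where [e / h] is the difference
   between the cross direction and [c]. *)
Lemma contact3 a c g h g1 h1 g2 h2 gv hv H00 H01 H02 H11 H12 H22 t0
    K00 K01 K02 K11 K12 K22 :
  a != c -> h != 0 -> g = (a + c) * h ->
  h1 = H02 - c * H12 + c ^+ 2 * H22 -> g1 = H01 - c * H11 + c ^+ 2 * H12 ->
  c * g1 - c ^+ 2 * h1 = H00 - c * H01 + c ^+ 2 * H02 ->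
  hv = H02 - a * H12 + a ^+ 2 * H22 -> gv = H01 - a * H11 + a ^+ 2 * H12 ->
  a * gv - a ^+ 2 * hv = H00 - a * H01 + a ^+ 2 * H02 ->
  t0 = c * g2 - c ^+ 2 * h2 ->
  t0 - a * g2 + a ^+ 2 * h2 = K00 - 2 * c * K01 + 2 * c ^+ 2 * K02 + c ^+ 2 * K11
    - 2 * c ^+ 3 * K12 + c ^+ 4 * K22 ->
  let u := g - a * h in let uv := gv - a * hv in
  K00 * h ^+ 4 - 2 * K01 * (h ^+ 3 * u) + 2 * K02 * (h ^+ 2 * u ^+ 2)
  + K11 * (h ^+ 2 * u ^+ 2) - 2 * K12 * (h * u ^+ 3) + K22 * u ^+ 4
  + (H00 * (4 * h ^+ 3 * hv) - 2 * H01 * (3 * h ^+ 2 * hv * u + h ^+ 3 * uv)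
  + (2 * H02 + H11) * (2 * h * hv * u ^+ 2 + 2 * h ^+ 2 * u * uv)
  - 2 * H12 * (hv * u ^+ 3 + 3 * h * u ^+ 2 * uv) + H22 * (4 * u ^+ 3 * uv)) = 0 ->
  let e := g - 2 * c * h in let e1 := g1 - 2 * c * h1 in let e2 := g2 - 2 * c * h2 in
  (h2 * e - h * e2) * e - 2 * e1 * (h1 * e - h * e1) = 0.
Proof.
move=> ac h0 gE h1E g1E ix0 hvE gvE j0 t0E TE u uv E e e1 e2.
pose z := g1 - (a + c) * h1.
(* Symmetry of the Hessian: the mixed second derivative in the directions [a] and [c] is
   [(c - a) * z] when computed along the first ray and [(a - c) * (gv - (a + c) * hv)] along the
   second. *)
have gv_eq : gv = (a + c) * hv - z.
  apply/eqP; rewrite -subr_eq0; apply/eqP/(@mulfI _ (a - c)); first by rewrite subr_eq0.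
  rewrite mulr0.
  have -> : (a - c) * (gv - ((a + c) * hv - z)) =
    (a * gv - a ^+ 2 * hv) - c * gv + c ^+ 2 * hv
    - ((c * g1 - c ^+ 2 * h1) - a * g1 + a ^+ 2 * h1) by rewrite /z; ring.
  by rewrite j0 ix0 gvE hvE g1E h1E; ring.
have uE : u = c * h by rewrite /u gE; ring.
have uvE : uv = c * hv - z by rewrite /uv gv_eq; ring.
have H00E : H00 = c * g1 - c ^+ 2 * h1 + c * H01 - c ^+ 2 * H02 by rewrite ix0; ring.
(* In the differentiated contact condition the [K] terms are [h ^ 4] times the third derivative in
   [TE], and the terms in [hv] cancel; what remains is [h ^ 3] times this equation. *)
have F : h * (t0 - a * g2 + a ^+ 2 * h2) + 2 * z * (g1 - 2 * c * h1) = 0.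
  apply: (@mulfI _ (h ^+ 3)); first by rewrite expf_neq0.
  rewrite mulr0 -[RHS]E TE uE uvE H00E h1E g1E; ring.
have -> : e = (a - c) * h by rewrite /e gE; ring.
rewrite -[RHS](mulr0 h) -[in RHS]F t0E /e1 /e2 /z; ring.
Qed.

End Contact.

Section ContactPoly.
Variable K : fieldType.
Implicit Types P Q : {poly K}.

(* The Hessian form at the vector [(h ^ 2, - u h, u ^ 2)], which is proportional to
   the direction [(1, - t, t ^ 2)] with [t = u / h]. *)
Definition contact_poly (h u H00 H01 H02 H11 H12 H22 : {poly K}) : {poly K} :=
  H00 * h ^+ 4 - (H01 * (h ^+ 3 * u)) *+ 2 + (H02 * (h ^+ 2 * u ^+ 2)) *+ 2
  + H11 * (h ^+ 2 * u ^+ 2) - (H12 * (h * u ^+ 3)) *+ 2 + H22 * u ^+ 4.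

Lemma horner_deriv_contact_poly h u H00 H01 H02 H11 H12 H22 x :
  let v (P : {poly K}) := P.[x] in let w (P : {poly K}) := P^`().[x] in
  (contact_poly h u H00 H01 H02 H11 H12 H22)^`().[x] =
  w H00 * v h ^+ 4 - 2 * w H01 * (v h ^+ 3 * v u) + 2 * w H02 * (v h ^+ 2 * v u ^+ 2)
  + w H11 * (v h ^+ 2 * v u ^+ 2) - 2 * w H12 * (v h * v u ^+ 3) + w H22 * v u ^+ 4
  + (v H00 * (4 * v h ^+ 3 * w h) - 2 * v H01 * (3 * v h ^+ 2 * w h * v u + v h ^+ 3 * w u)
  + (2 * v H02 + v H11) * (2 * v h * w h * v u ^+ 2 + 2 * v h ^+ 2 * v u * w u)
  - 2 * v H12 * (w h * v u ^+ 3 + 3 * v h * v u ^+ 2 * w u)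
  + v H22 * (4 * v u ^+ 3 * w u)).
Proof.
rewrite /contact_poly !exprS !expr0 !mulr1 /=.
rewrite !(derivD, derivN, derivMn, derivM) !(hornerD, hornerN, hornerM, hornerMn); ring.
Qed.

Lemma size_mul_leS P Q m n : (size P <= m.+1)%N -> (size Q <= n.+1)%N ->
  (size (P * Q)%R <= (m + n).+1)%N.
Proof. by move=> Pm Qn; apply: leq_trans (size_polyMleq _ _) _; lia. Qed.

Lemma size_exp_leS P m n : (size P <= m.+1)%N -> (size (P ^+ n) <= (n * m).+1)%N.
Proof.
move=> Pm; elim: n => [|n IH]; first by rewrite expr0 size_poly1.
by rewrite exprS mulSn; apply: size_mul_leS.
Qed.

Lemma size_add_leq P Q m : (size P <= m)%N -> (size Q <= m)%N -> (size (P + Q)%R <= m)%N.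
Proof. by move=> Pm Qm; rewrite (leq_trans (size_polyD _ _)) // geq_max Pm. Qed.

Lemma size_muln_leq P m k : (size P <= m)%N -> (size (P *+ k) <= m)%N.
Proof.
move=> Pm; elim: k => [|k IH]; first by rewrite mulr0n size_poly0.
by rewrite mulrS size_add_leq.
Qed.

(** Every term is a product of five of the listed polynomials. *)
Lemma size_contact_poly h u H00 H01 H02 H11 H12 H22 d :
  (forall P, P \in [:: h; u; H00; H01; H02; H11; H12; H22] -> (size P <= d.+1)%N) ->
  (size (contact_poly h u H00 H01 H02 H11 H12 H22) <= (5 * d).+1)%N.
Proof.
move=> s.
have [sh su] : (size h <= d.+1)%N /\ (size u <= d.+1)%N by split; apply: s; rewrite !inE eqxx ?orbT.
have B (H : {poly K}) m n : (size H <= d.+1)%N -> (m + n = 4)%N ->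
    (size (H * (h ^+ m * u ^+ n))%R <= (5 * d).+1)%N.
  move=> sH mn; have -> : (5 * d = d + (m * d + n * d))%N by rewrite -mulnDl mn.
  by apply: size_mul_leS => //; apply: size_mul_leS; apply: size_exp_leS.
have B' (H : {poly K}) m n : H \in [:: h; u; H00; H01; H02; H11; H12; H22] -> (m + n = 4)%N ->
    (size (H * (h ^+ m * u ^+ n))%R <= (5 * d).+1)%N by move=> /s; apply: B.
rewrite /contact_poly; apply: size_add_leq; last first.
  by have := @B' H22 0 4; rewrite expr0 mul1r; apply; rewrite // !inE eqxx ?orbT.
apply: size_add_leq; last first.
  rewrite size_polyN; apply: size_muln_leq.
  by have := @B' H12 1 3; rewrite expr1; apply; rewrite // !inE eqxx ?orbT.
apply: size_add_leq; last by apply: B'; rewrite // !inE eqxx ?orbT.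
apply: size_add_leq; last first.
  by apply: size_muln_leq; apply: B'; rewrite // !inE eqxx ?orbT.
apply: size_add_leq; last first.
  rewrite size_polyN; apply: size_muln_leq.
  by have := @B' H01 3 1; rewrite expr1; apply; rewrite // !inE eqxx ?orbT.
by have := @B' H00 4 0; rewrite expr0 mulr1; apply; rewrite // !inE eqxx ?orbT.
Qed.

(** Leading coefficients show that the degrees of [P] and [Q] agree modulo [p], hence agree.
    Subtracting the multiple of [Q] that cancels the leading term leaves a solution of smaller
    degree, which must be zero. *)
Lemma deriv_ratio_eq0 (p : nat) P Q : p \in [pchar K] ->
  (size P <= p)%N -> (size Q <= p)%N -> Q != 0 ->
  P^`() * Q = P * Q^`() -> exists k, P = k *: Q.
Proof.
move=> charp sP sQ Q0 E.
have [P0|P0] := eqVneq P 0; first by exists 0; rewrite scale0r.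
have natr_inj (a b : nat) : (a < p)%N -> (b < p)%N -> a%:R = b%:R :> K -> a = b.
  wlog ab : a b / (a <= b)%N.
    move=> W ap bp e; case/orP: (leq_total a b) => ab; first exact: W ab ap bp e.
    by rewrite (W _ _ ab bp ap (esym e)).
  move=> ap bp /eqP; rewrite eq_sym -subr_eq0 -natrB // -(dvdn_pcharf charp) => /dvdnP[k].
  by case: k => [|k] /=; lia.
(* For a constant [A] both sides are zero, which also covers the truncated predecessor. *)
have lead (A B : {poly K}) : A != 0 -> B != 0 ->
    (A^`() * B)`_((size A).-1 + (size B).-1).-1 = (lead_coef A * lead_coef B) *+ (size A).-1.
  move=> A0 B0; have [a0|a0] := posnP (size A).-1.
    have -> : A^`() = 0 by rewrite (size1_polyC (p := A)) ?derivC //; lia.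
    by rewrite mul0r coef0 a0.
  set m := (size A).-1 in a0 *; set n := (size B).-1.
  have mn : ((m + n).-1 = m.-1 + n)%N by lia.
  rewrite coefM mn; have lt : (m.-1 < (m.-1 + n).+1)%N by lia.
  rewrite (bigD1 (Ordinal lt)) //= addKn coef_deriv prednK // big1 ?addr0.
    by rewrite mulrnAl.
  move=> [j /= jlt]; rewrite -val_eqE /= => jm.
  case: (ltnP j m.-1) => jm1.
    have -> : B`_(m.-1 + n - j) = 0; last by rewrite mulr0.
    by apply: nth_default; move: jm1; rewrite /n; move: (size B) m.-1 => b m' {}; lia.
  have -> : A^`()`_j = 0; last by rewrite mul0r.
  rewrite coef_deriv nth_default ?mul0rn //.
  by move: jm jm1 a0; rewrite /m; move: (size A) => k {}; lia.
have deg_eq (A B : {poly K}) : A != 0 -> B != 0 -> (size A <= p)%N -> (size B <= p)%N ->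
    A^`() * B = A * B^`() -> size A = size B.
  move=> A0 B0 sA sB e.
  have AB : lead_coef A * lead_coef B *+ (size A).-1 = lead_coef A * lead_coef B *+ (size B).-1.
    by rewrite -lead // e [A * _]mulrC addnC lead // [lead_coef B * _]mulrC.
  have sA0 : (0 < size A)%N by rewrite lt0n size_poly_eq0.
  have sB0 : (0 < size B)%N by rewrite lt0n size_poly_eq0.
  have /natr_inj : (size A).-1%:R = (size B).-1%:R :> K.
    have AB0 : lead_coef A * lead_coef B != 0 by rewrite mulf_neq0 ?lead_coef_eq0.
    by apply: (mulfI AB0); rewrite !mulr_natr.
  by lia.
have PQ := deg_eq P Q P0 Q0 sP sQ E.
pose k := lead_coef P / lead_coef Q; exists k; apply/eqP; rewrite -subr_eq0.
have kE : (P - k *: Q)^`() * Q = (P - k *: Q) * Q^`().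
  by rewrite derivB derivZ !mulrBl E -!scalerAl [Q^`() * Q]mulrC.
apply: contraT => R0; have ltR : (size (P - k *: Q)%R < size Q)%N.
  have Q1 : (0 < size Q)%N by rewrite lt0n size_poly_eq0.
  rewrite -(prednK Q1) ltnS; apply/leq_sizeP => j; rewrite leq_eqVlt => /orP[/eqP<-|jQ].
    by rewrite coefB coefZ -{1}PQ -!lead_coefE /k divfK ?subrr ?lead_coef_eq0.
  have sj : (size Q <= j)%N by rewrite -(prednK Q1).
  by rewrite coefB coefZ !nth_default ?mulr0 ?subr0 ?PQ.
have := deg_eq _ _ R0 Q0 (leq_trans (ltnW ltR) sQ) sQ kE.
by move=> e; rewrite e ltnn in ltR.
Qed.
End ContactPoly.

(** * Families of rays with many crossings *)

Section Crossings.
Variables (K : fieldType) (I : finType) (r : I -> K * K * K).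
Variables (N : I -> {set I}) (x : I -> I -> K) (D p : nat).
Hypothesis x_meet : forall i j, j \in N i -> meet_at (x i j) (r i) (r j).
Hypothesis x_inj : forall i, {in N i &, injective (x i)}.
Hypothesis N_large : forall i, (15 * D <= #|N i|)%N.
Hypothesis charp : p \in [pchar K].
Hypothesis Dp : (6 * D <= p)%N.

(** Distinct neighbours give distinct roots; conditions checked at crossings thereby become
    identities along the ray. *)
Lemma crossings_poly_eq0 i (J : {set I}) (P : {poly K}) :
  J \subset N i -> (size P <= #|J|)%N -> {in J, forall j, P.[x i j] = 0} -> P = 0.
Proof.
move=> JN sP P0; apply: (@roots_geq_poly_eq0 _ _ [seq x i j | j <- enum J]).
- by apply/allP => _ /mapP[j jJ ->]; rewrite mem_enum in jJ; apply/eqP/P0.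
- have inj : {in enum J &, injective (x i)}.
    by move=> j k; rewrite !mem_enum => jJ kJ; apply: x_inj; apply: (subsetP JN).
  by rewrite (map_inj_in_uniq inj) enum_uniq.
by rewrite size_map -cardE.
Qed.

(* [M] stands for the polynomials in three variables, [d0 d1 d2] for the partial
   derivatives and [rho i] for the restriction to the ray [i]. *)
Variables (M : Type) (d0 d1 d2 : M -> M) (rho : I -> M -> {poly K}) (f : M).
Hypothesis rho_deriv : forall i F, (rho i F)^`() =
  rho i (d0 F) - (r i).1.1 *: rho i (d1 F) + (r i).1.1 ^+ 2 *: rho i (d2 F).
Hypothesis rho_meet : forall i j t F, meet_at t (r i) (r j) -> (rho i F).[t] = (rho j F).[t].
Hypothesis d10 : forall F, d1 (d0 F) = d0 (d1 F).
Hypothesis d20 : forall F, d2 (d0 F) = d0 (d2 F).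
Hypothesis d21 : forall F, d2 (d1 F) = d1 (d2 F).
Hypothesis fr : forall i, rho i f = 0.
Hypothesis size1 : forall i d, List.In d [:: d0; d1; d2] ->
  (size (rho i (d f)) <= (3 * D - 3).+1)%N.
Hypothesis size2 : forall i d e, List.In d [:: d0; d1; d2] -> List.In e [:: d0; d1; d2] ->
  (size (rho i (d (e f))) <= (3 * D - 3).+1)%N.
Hypothesis D0 : (0 < D)%N.

Let h i := rho i (d2 f).
Let g i := rho i (d1 f).
Let a i := (r i).1.1.
Let H i (d e : M -> M) := rho i (d (e f)).

Let contact i := contact_poly (h i) (g i - a i *: h i)
  (H i d0 d0) (H i d0 d1) (H i d0 d2) (H i d1 d1) (H i d1 d2) (H i d2 d2).

Let horner_rho i F t : (rho i F)^`().[t] =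
  (rho i (d0 F)).[t] - a i * (rho i (d1 F)).[t] + a i ^+ 2 * (rho i (d2 F)).[t].
Proof. by rewrite rho_deriv !hornerE. Qed.

Let grad0 i : rho i (d0 f) = a i *: g i - a i ^+ 2 *: h i.
Proof.
have := rho_deriv i f; rewrite fr deriv0 => /esym/eqP.
by rewrite -addrA addr_eq0 opprD opprK => /eqP.
Qed.

Let grad0' i t : (rho i (d0 f))^`().[t] = a i * (g i)^`().[t] - a i ^+ 2 * (h i)^`().[t].
Proof. by rewrite grad0 derivB !derivZ !hornerE. Qed.

Let h' i t : (h i)^`().[t] = (H i d0 d2).[t] - a i * (H i d1 d2).[t] + a i ^+ 2 * (H i d2 d2).[t].
Proof. exact: horner_rho. Qed.

Let g' i t : (g i)^`().[t] = (H i d0 d1).[t] - a i * (H i d1 d1).[t] + a i ^+ 2 * (H i d1 d2).[t].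
Proof. by rewrite horner_rho d21. Qed.

Let f0' i t : a i * (g i)^`().[t] - a i ^+ 2 * (h i)^`().[t] =
  (H i d0 d0).[t] - a i * (H i d0 d1).[t] + a i ^+ 2 * (H i d0 d2).[t].
Proof. by rewrite -grad0' horner_rho d10 d20. Qed.

Let hess_ray i t : (H i d0 d0).[t] - a i * (H i d0 d1).[t] + a i ^+ 2 * (H i d0 d2).[t]
   - a i * ((H i d0 d1).[t] - a i * (H i d1 d1).[t] + a i ^+ 2 * (H i d1 d2).[t])
   + a i ^+ 2 * ((H i d0 d2).[t] - a i * (H i d1 d2).[t] + a i ^+ 2 * (H i d2 d2).[t]) = 0.
Proof. by rewrite -f0' -g' -h'; ring. Qed.

Let cross_g i j : j \in N i -> (g i).[x i j] = (a i + a j) * (h i).[x i j].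
Proof.
move=> jN; have Mij := x_meet jN; have [ne _ _] := Mij; rewrite addrC.
apply: (@cross_slope _ _ _ _ _ ((rho i (d0 f)).[x i j])); first by rewrite eq_sym; exact: ne.
  by rewrite grad0 !hornerE.
by rewrite /g /h !(rho_meet _ Mij) grad0 !hornerE.
Qed.

(** At each crossing the second derivative of [f] along the other ray vanishes. The contact
    polynomial has degree at most [5 * (3 * D - 3)], which is less than the [15 * D] available
    crossings. *)
Let contact_eq0 i : contact i = 0.
Proof.
apply: (crossings_poly_eq0 (subxx (N i))) => [|j jN].
  rewrite (@leq_trans (5 * (3 * D - 3)).+1) //; last by rewrite (leq_trans _ (N_large i)) //; lia.
  apply: size_contact_poly => P; rewrite !inE.
  have in0 : List.In d0 [:: d0; d1; d2] by left.
  have in1 : List.In d1 [:: d0; d1; d2] by right; left.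
  have in2 : List.In d2 [:: d0; d1; d2] by right; right; left.
  case/orP => [/eqP->|]; first exact: (size1 i in2).
  case/orP => [/eqP->|].
    apply: size_add_leq; first exact: (size1 i in1).
    by rewrite size_polyN (leq_trans (size_scale_leq _ _)) //; exact: (size1 i in2).
  case/orP => [/eqP->|]; first exact: (size2 i in0 in0).
  case/orP => [/eqP->|]; first exact: (size2 i in0 in1).
  case/orP => [/eqP->|]; first exact: (size2 i in0 in2).
  case/orP => [/eqP->|]; first exact: (size2 i in1 in1).
  case/orP => [/eqP->|/eqP->]; first exact: (size2 i in1 in2).
  exact: (size2 i in2 in2).
have Mij := x_meet jN; have := hess_ray j (x i j); rewrite /H -!(rho_meet _ Mij) => E.
have := contact2 _ E => /(_ (a i) (g i).[x i j] (h i).[x i j]).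
rewrite [a j + _]addrC => /(_ (cross_g jN)) /= <-.
rewrite /contact /contact_poly /H !(hornerD, hornerN, hornerMn, hornerM, horner_exp, hornerZ); ring.
Qed.

Let horner_rho2 i F t : (rho i F)^`()^`().[t] =
  (rho i (d0 (d0 F))).[t] - a i * (rho i (d0 (d1 F))).[t] + a i ^+ 2 * (rho i (d0 (d2 F))).[t]
  - a i * ((rho i (d0 (d1 F))).[t] - a i * (rho i (d1 (d1 F))).[t] + a i ^+ 2 * (rho i (d1 (d2 F))).[t])
  + a i ^+ 2 * ((rho i (d0 (d2 F))).[t] - a i * (rho i (d1 (d2 F))).[t] + a i ^+ 2 * (rho i (d2 (d2 F))).[t]).
Proof.
rewrite rho_deriv derivD derivB !derivZ !(hornerD, hornerN, hornerZ) !horner_rho.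
by rewrite /a !(d10, d20, d21).
Qed.

(** The quadratic polynomial in [t] has the roots [a i] and [g i / h i - a i]; the quotient
    [e i / h i] is their difference. *)
Let e i := g i - (2 * a i) *: h i.

Let cross_e i j : j \in N i -> (e i).[x i j] = (a j - a i) * (h i).[x i j].
Proof. by move=> jN; rewrite /e !(hornerD, hornerN, hornerZ) cross_g //; ring. Qed.

Let J i := [set j in N i | (h i).[x i j] != 0].

Let J_large i : h i != 0 -> (#|N i| <= #|J i| + (3 * D - 3))%N.
Proof.
move=> h0; rewrite leqNgt; apply: contra h0 => lt.
pose Z := [set j in N i | (h i).[x i j] == 0].
have NE : #|N i| = (#|J i| + #|Z|)%N.
  rewrite -(cardsID Z (N i)) addnC; congr (_ + _)%N; apply: eq_card => j.
    by rewrite !inE; case: (j \in N i) => //=; rewrite andbT.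
  by rewrite !inE; case: (j \in N i).
have in2 : List.In d2 [:: d0; d1; d2] by right; right; left.
apply/eqP/(@crossings_poly_eq0 i Z).
- by apply/subsetP => j; rewrite inE => /andP[].
- by rewrite (leq_trans (size1 i in2)) // -(ltn_add2l #|J i|) -NE.
by move=> j; rewrite inE => /andP[_ /eqP].
Qed.

(** The left side is [e i ^+ 3] times the second derivative of [h i / e i]. It has degree at most
    [3 * (3 * D - 3)] and vanishes by [contact3] at the more numerous crossings from [J i]. *)
Let curvature i : h i != 0 ->
  ((h i)^`()^`() * e i - h i * (e i)^`()^`()) * e i
  - ((e i)^`() * ((h i)^`() * e i - h i * (e i)^`())) *+ 2 = 0.
Proof.
move=> h0; apply: (@crossings_poly_eq0 i (J i)).
- by apply/subsetP => j; rewrite inE => /andP[].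
- have in1 : List.In d1 [:: d0; d1; d2] by right; left.
  have in2 : List.In d2 [:: d0; d1; d2] by right; right; left.
  have sh : (size (h i) <= (3 * D - 3).+1)%N by exact: (size1 i in2).
  have se : (size (e i) <= (3 * D - 3).+1)%N.
    apply: size_add_leq; first exact: (size1 i in1).
    by rewrite size_polyN (leq_trans (size_scale_leq _ _)).
  have sd (P : {poly K}) : (size P <= (3 * D - 3).+1)%N -> (size P^`() <= (3 * D - 3).+1)%N.
    have [->|/lt_size_deriv/ltnW/leq_trans] := eqVneq P 0; last by apply.
    by rewrite deriv0 size_poly0.
  have JN := leq_trans (N_large i) (J_large h0).
  apply: (@leq_trans (3 * D - 3 + (3 * D - 3) + (3 * D - 3)).+1); last by move: JN; lia.
  have s3 (P Q R : {poly K}) : (size P <= (3 * D - 3).+1)%N -> (size Q <= (3 * D - 3).+1)%N ->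
      (size R <= (3 * D - 3).+1)%N ->
      (size (P * Q * R)%R <= (3 * D - 3 + (3 * D - 3) + (3 * D - 3)).+1)%N.
    by move=> sP sQ sR; do 2?apply: size_mul_leS.
  apply: size_add_leq.
    rewrite mulrBl; apply: size_add_leq; rewrite ?size_polyN; apply: s3 => //.
      exact: (sd _ (sd _ sh)).
    exact: (sd _ (sd _ se)).
  rewrite size_polyN; apply: size_muln_leq; rewrite mulrC mulrBl.
  by apply: size_add_leq; rewrite ?size_polyN; apply: s3 => //;
    first [exact: (sd _ sh) | exact: (sd _ se)].
move=> j; rewrite inE => /andP[jN hj0]; have Mij := x_meet jN; have [ne _ _] := Mij.
have ne' : a j != a i by rewrite eq_sym.
have v F := rho_meet F Mij.
have hj : (h j).[x i j] = (h i).[x i j] by rewrite /h v.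
have gj : (g j).[x i j] = (g i).[x i j] by rewrite /g v.
set t := x i j in v hj gj hj0 *.
have t0E : (rho i (d0 f))^`()^`().[t] = a i * (g i)^`()^`().[t] - a i ^+ 2 * (h i)^`()^`().[t].
  by rewrite grad0 !(derivB, derivZ) !(hornerD, hornerN, hornerZ).
(* Both sides differentiate [f] twice in the direction of ray [i] and once in that of ray [j]. *)
have TE : (rho i (d0 f))^`()^`().[t] - a j * (g i)^`()^`().[t] + a j ^+ 2 * (h i)^`()^`().[t] =
    (H j d0 d0)^`().[t] - 2 * a i * (H j d0 d1)^`().[t] + 2 * a i ^+ 2 * (H j d0 d2)^`().[t]
    + a i ^+ 2 * (H j d1 d1)^`().[t] - 2 * a i ^+ 3 * (H j d1 d2)^`().[t]
    + a i ^+ 4 * (H j d2 d2)^`().[t].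
  by rewrite !horner_rho2 !horner_rho -!v !(d10, d20, d21); ring.
(* The contact polynomial of the crossing ray [j] is identically zero, hence so is its derivative at
   the crossing. *)
have C := horner_deriv_contact_poly (h j) (g j - a j *: h j) (H j d0 d0) (H j d0 d1)
  (H j d0 d2) (H j d1 d1) (H j d1 d2) (H j d2 d2) t.
rewrite -/(contact j) contact_eq0 deriv0 horner0 /= derivB derivZ !(hornerD, hornerN, hornerZ) in C.
have vH : forall d1' d2', (H j d1' d2').[t] = (H i d1' d2').[t] by move=> d1' d2'; rewrite /H v.
rewrite hj gj !vH in C.
have hE := h' j t; have gE := g' j t; have fE := f0' j t; rewrite !vH in hE gE fE.
have := contact3 ne' hj0 (etrans (cross_g jN) (congr1 (fun y => y * _) (addrC _ _)))
  (h' i t) (g' i t) (f0' i t) hE gE fE t0E TE (esym C).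
rewrite /= => N0; rewrite !(hornerD, hornerN, hornerM, hornerMn) /e !(derivB, derivZ).
by rewrite !(hornerD, hornerN, hornerZ) -[RHS]N0; ring.
Qed.

(** By [curvature], [h i / e i] has a constant derivative [k], and then equals [k * x + b]. At a
    crossing it is [1 / (a j - a i)], while [(a j - a i) * x i j] is the difference of the second
    coordinates of the rays. *)
Lemma crossing_rays_collinear i : h i != 0 ->
  exists (J : {set I}) (k b : K), [/\ J \subset N i, (#|N i| <= #|J| + (3 * D - 3))%N
    & {in J, forall j, k * ((r j).1.2 - (r i).1.2) + b * ((r j).1.1 - (r i).1.1) = 1}].
Proof.
move=> h0; have JN := leq_trans (N_large i) (J_large h0).
have [j0 j0J] : exists j, j \in J i by apply/set0Pn; rewrite -card_gt0; lia.
have e0 : e i != 0.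
  apply: contraTneq j0J => e0; rewrite inE; apply/negP => /andP[jN].
  have := cross_e jN; rewrite e0 horner0 => /esym/eqP; rewrite mulf_eq0 subr_eq0.
  by have [ne _ _] := x_meet jN; rewrite eq_sym (negPf ne) /= => ->.
have in1 : List.In d1 [:: d0; d1; d2] by right; left.
have in2 : List.In d2 [:: d0; d1; d2] by right; right; left.
have sh : (size (h i) <= (3 * D - 3).+1)%N by exact: (size1 i in2).
have se : (size (e i) <= (3 * D - 3).+1)%N.
  apply: size_add_leq; first exact: (size1 i in1).
  by rewrite size_polyN (leq_trans (size_scale_leq _ _)).
have se' : (size (e i)^`() <= (3 * D - 3).+1)%N.
  have [->|/lt_size_deriv/ltnW/leq_trans] := eqVneq (e i) 0; last by apply.
  by rewrite deriv0 size_poly0.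
have sh' : (size (h i)^`() <= (3 * D - 3).+1)%N.
  have [->|/lt_size_deriv/ltnW/leq_trans] := eqVneq (h i) 0; last by apply.
  by rewrite deriv0 size_poly0.
(* [deriv_ratio_eq0] needs sizes at most [p]; the largest one, that of [e i * e i], is at most
   [6 * D - 5]. *)
have dp : ((3 * D - 3 + (3 * D - 3)).+1 <= p)%N by lia.
have dp' : ((1 + (3 * D - 3)).+1 <= p)%N by lia.
have [k kE] : exists k, (h i)^`() * e i - h i * (e i)^`() = k *: (e i * e i).
  apply: (deriv_ratio_eq0 charp).
  - by apply: leq_trans dp; apply: size_add_leq; rewrite ?size_polyN; apply: size_mul_leS.
  - by apply: leq_trans dp; apply: size_mul_leS.
  - by rewrite mulf_neq0.
  have C := curvature h0; apply/eqP; rewrite -subr_eq0; apply/eqP.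
  by rewrite -[RHS](mulr0 (e i)) -[in RHS]C !(derivM, derivB); ring.
have [b bE] : exists b, h i - (k *: 'X) * e i = b *: e i.
  apply: (deriv_ratio_eq0 charp) => //.
  - apply: leq_trans dp'; apply: size_add_leq; first by rewrite (leq_trans sh) // ltnS; lia.
    rewrite size_polyN (size_mul_leS (m := 1)) //.
    by rewrite (leq_trans (size_scale_leq _ _)) ?size_polyX.
  - by apply: leq_trans se _; lia.
  apply/eqP; rewrite -subr_eq0; apply/eqP.
  rewrite derivB derivM derivZ derivX -[RHS](subrr (k *: (e i * e i))) -{1}kE.
  by rewrite -!mul_polyC; ring.
exists (J i), k, b; split; [|exact: (J_large h0)|].
  by apply/subsetP => j; rewrite inE => /andP[].
move=> j; rewrite inE => /andP[jN hj0]; have [ne bj _] := x_meet jN.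
have := congr1 (horner^~ (x i j)) bE.
rewrite /= hornerD hornerN hornerM !hornerZ hornerX (cross_e jN) => E.
apply: (mulIf hj0); rewrite mul1r.
have -> : (r j).1.2 - (r i).1.2 = (a j - a i) * x i j.
  by apply/eqP; rewrite subr_eq; apply/eqP; move/eqP: bj; rewrite subr_eq => /eqP->; rewrite /a; ring.
by rewrite -[RHS](subrK (k * x i j * ((a j - a i) * (h i).[x i j]))) E /a; ring.
Qed.

End Crossings.

(** * A vanishing polynomial of least degree *)

Section VanishingPolynomial.
Variables (K : fieldType) (I : finType) (r : I -> K * K * K).
Variables (N : I -> {set I}) (x : I -> I -> K) (D p : nat).
Hypothesis x_meet : forall i j, j \in N i -> meet_at (x i j) (r i) (r j).
Hypothesis x_inj : forall i, {in N i &, injective (x i)}.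
Hypothesis N_large : forall i, (15 * D <= #|N i|)%N.
Hypothesis charp : p \in [pchar K].
Hypothesis Dp : (6 * D <= p)%N.

(** Once the third partial derivative vanishes, the first one equals the second times the direction
    of either ray at a crossing. The directions differ, so the second one vanishes at all
    crossings. *)
Lemma on_ray_grad_eq0 f i : (msize f <= 3 * D - 2)%N ->
  (forall i, on_ray (r i) f = 0) -> on_ray (r i) f^`M(ix2) = 0 ->
  on_ray (r i) f^`M(ix1) = 0 /\ on_ray (r i) f^`M(ix0) = 0.
Proof.
move=> fD fr h0; have m0 := deriv2_on_ray (fr i); rewrite h0 scaler0 subr0 in m0.
have g0 : on_ray (r i) f^`M(ix1) = 0; last by rewrite m0 g0 scaler0.
apply: (crossings_poly_eq0 x_inj (subxx (N i))) => [|j jN].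
  rewrite (leq_trans (size_on_ray _ _)) // (leq_trans _ (N_large i)) //.
  have [->|/msize_mderiv_lt] := eqVneq f^`M(ix1) 0; first by rewrite msize0.
  by lia.
have [ne _ _] := x_meet jN; have M := x_meet jN.
have /(congr1 (horner^~ (x i j))) := deriv2_on_ray (fr j).
have /(congr1 (horner^~ (x i j))) := m0; rewrite /= !hornerE.
rewrite -!(horner_on_ray_meet _ M) h0 horner0 mulr0 subr0 => -> /eqP.
by rewrite -subr_eq0 -mulrBl mulf_eq0 subr_eq0 (negPf ne) => /eqP.
Qed.

(** Descent on the degree: if the third partial derivative vanishes on all rays, then so do the
    others, and a nonzero one replaces [f]. If all three are zero, [f] is constant, hence zero on
    looking at ray [i]. *)
Lemma exists_minimal_vanishing (i : I) : (#|I| * (3 * D - 2) < D ^ 3)%N ->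
  exists f : {mpoly K[3]}, [/\ (msize f <= 3 * D - 2)%N,
    forall i, on_ray (r i) f = 0 & exists i, on_ray (r i) f^`M(ix2) != 0].
Proof.
move=> /(@exists_vanishing K I r D)[f [f0 fD fr]].
move: {2}(msize f) (leqnn (msize f)) => n.
elim: n f f0 fD fr => [|n IH] f f0 fD fr fn.
  by rewrite leqn0 msize_poly_eq0 (negPf f0) in fn.
have [/existsP[j hj]|] := boolP [exists j, on_ray (r j) f^`M(ix2) != 0].
  by exists f; split=> //; exists j.
rewrite negb_exists => /forallP/(_ _)/negPn/eqP h0.
have step k : f^`M(k) != 0 -> (forall j, on_ray (r j) f^`M(k) = 0) ->
    exists f : {mpoly K[3]}, [/\ (msize f <= 3 * D - 2)%N,
    forall i, on_ray (r i) f = 0 & exists i, on_ray (r i) f^`M(ix2) != 0].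
  move=> f'0 f'r; have lt := msize_mderiv_lt f'0.
  apply: (IH _ f'0 _ f'r); first exact: leq_trans (ltnW lt) fD.
  by rewrite -ltnS (leq_trans lt).
have [d2|/step] := eqVneq f^`M(ix2) 0; last by apply; exact: h0.
have [d1|/step] := eqVneq f^`M(ix1) 0; last first.
  by apply=> j; have [] := on_ray_grad_eq0 fD fr (h0 j).
have [d0|/step] := eqVneq f^`M(ix0) 0; last first.
  by apply=> j; have [] := on_ray_grad_eq0 fD fr (h0 j).
have fC : f = (f@_0)%:MP.
  apply: (mpoly_deriv_eq0 charp); first by lia.
  case=> -[|[|[|//]]] lt3.
  - by rewrite -d0; congr mderiv; apply/val_inj; rewrite /= inordK.
  - by rewrite -d1; congr mderiv; apply/val_inj; rewrite /= inordK.
  - by rewrite -d2; congr mderiv; apply/val_inj; rewrite /= inordK.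
have := fr i; rewrite fC /on_ray mmapC => /eqP; rewrite polyC_eq0 => /eqP c0.
by rewrite fC c0 mpolyC0 eqxx in f0.
Qed.

Theorem crossing_rays_theorem (i : I) : (#|I| * (3 * D - 2) < D ^ 3)%N ->
  exists (i : I) (J : {set I}) (k b : K),
    [/\ J \subset N i, (#|N i| <= #|J| + (3 * D - 3))%N
      & {in J, forall j, k * ((r j).1.2 - (r i).1.2) + b * ((r j).1.1 - (r i).1.1) = 1}].
Proof.
move=> ltI; have D0 : (0 < D)%N by case: D ltI.
have [f [fD fr [j hj]]] := exists_minimal_vanishing i ltI.
have szD (F : {mpoly K[3]}) k : (msize F <= 3 * D - 2)%N -> (msize F^`M(k) <= 3 * D - 2)%N.
  move=> FD; have [->|/msize_mderiv_lt/ltnW/leq_trans] := eqVneq F^`M(k) 0.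
    by rewrite msize0.
  by apply.
have szR l (F : {mpoly K[3]}) : (msize F <= 3 * D - 2)%N ->
    (size (on_ray (r l) F) <= (3 * D - 3).+1)%N.
  by move=> FD; rewrite (leq_trans (size_on_ray _ _)) // (leq_trans FD) //; lia.
have szd d : List.In d [:: @mderiv 3 K ix0; mderiv ix1; mderiv ix2] ->
    forall F, (msize F <= 3 * D - 2)%N -> (msize (d F) <= 3 * D - 2)%N.
  by case=> [<-|[<-|[<-|[]]]] F; apply: szD.
exists j; apply: (crossing_rays_collinear x_meet x_inj N_large charp Dp
  (d0 := mderiv ix0) (d1 := mderiv ix1) (d2 := mderiv ix2) (rho := fun i => on_ray (r i))
  (f := f)) => //.
- by move=> l F; apply: deriv_on_ray.
- by move=> l m t F; apply: horner_on_ray_meet.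
- by move=> F; apply: mderiv_comm.
- by move=> F; apply: mderiv_comm.
- by move=> F; apply: mderiv_comm.
- by move=> l d dd; apply/szR/szd.
- by move=> l d e dd ee; apply/szR/szd/szd.
Qed.

End VanishingPolynomial.

(** * Lines that are rich in a grid *)

(** Let [Z] maximise [w]. Removing a vertex of degree [d] from [Z] lowers [e] by at most [2 * d] and
    adds [2 * L], so [L <= d]. Comparison with the full vertex set shows that [Z] is not empty. *)
Lemma min_degree_subgraph (V : finType) (E : rel V) (L : nat) :
  ssrbool.symmetric E -> (2 * L * #|V| < \sum_(x : V) #|[set y | E x y]|)%N ->
  exists Z : {set V}, Z != set0 /\
    forall x, x \in Z -> (L <= #|[set y in Z | E x y]|)%N.
Proof.
move=> symE ltE; pose e (Z : {set V}) := (\sum_(x in Z) #|[set y in Z | E x y]|)%N.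
pose w Z := (e Z + 2 * L * #|~: Z|)%N.
case: (@arg_maxnP _ set0 predT w) => // Z _ Zmax.
exists Z; split.
  apply: contraTneq (Zmax setT isT) => ->.
  rewrite -ltnNge /w /e big_set0 setCT cards0 muln0 addn0 add0n setC0 cardsT.
  apply: leq_trans ltE _; rewrite [leqRHS](eq_bigl predT) => [|x]; last by rewrite inE.
  by apply: leq_sum => x _; apply/subset_leq_card/subsetP => y; rewrite !inE.
move=> v vZ; have := Zmax (Z :\ v) isT; rewrite /w.
have -> : #|~: (Z :\ v)| = (#|~: Z|).+1.
  have := cardsC Z; have := cardsC (Z :\ v); have := cardsD1 v Z.
  by rewrite vZ; lia.
set d := #|[set y in Z | E v y]|.
have eZ : (e Z <= d + (e (Z :\ v) + d))%N.
  rewrite /e (bigD1 v) //= -/d leq_add2l.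
  rewrite (eq_bigl (mem (Z :\ v))) => [|x]; last by rewrite !inE andbC.
  apply: (@leq_trans (\sum_(x in Z :\ v) (#|[set y in Z :\ v | E x y]| + E x v))%N).
    apply: leq_sum => x _; rewrite (cardsD1 v) inE vZ /= addnC leq_add2r.
    by apply/subset_leq_card/subsetP => y; rewrite !inE andbA.
  rewrite big_split /= leq_add2l -big_mkcondr /= sum1_card.
  apply/subset_leq_card/subsetP => y; rewrite unfold_in !inE => /andP[/andP[_ ->] Eyv].
  by rewrite symE Eyv.
by lia.
Qed.

Lemma sum_sqr_ge (T : finType) (J : T -> nat) :
  ((\sum_t J t) ^ 2 <= #|T| * \sum_t J t ^ 2)%N.
Proof.
have E : (\sum_t \sum_u (J t ^ 2 + J u ^ 2) = 2 * (#|T| * \sum_t J t ^ 2))%N.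
  under eq_bigr do rewrite big_split /= sum_nat_const.
  by rewrite big_split /= sum_nat_const -big_distrr /= addnn -mul2n.
have F : ((\sum_t J t) ^ 2 = \sum_t \sum_u J t * J u)%N.
  by rewrite -mulnn big_distrlr.
rewrite -(leq_pmul2l (isT : 0 < 2)%N) -E F big_distrr /=.
apply: leq_sum => t _; rewrite big_distrr /=; apply: leq_sum => u _.
by case: (nat_Cauchy (J t) (J u)).
Qed.

(* A transcendental [th] puts the rays of the two families in general position:
   no two rays of the same family meet. *)
Lemma exists_generic (F : fieldType) :
  exists (K : fieldType) (phi : {rmorphism F -> K}) (th : K),
    forall a b c d : F, phi a + phi b * th + phi c * th ^+ 2 + phi d * th ^+ 3 = 0 ->
      [/\ a = 0, b = 0, c = 0 & d = 0].
Proof.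
pose K := {fraction {poly F}}.
pose phi : {rmorphism F -> K} := @tofrac {poly F} \o polyC.
exists K, phi, (tofrac ('X : {poly F})) => a b c d.
rewrite /phi /= -!rmorphXn -!rmorphM -!rmorphD /= => /eqP.
rewrite tofrac_eq0 => /eqP/polyP P.
have := P 0%N; have := P 1%N; have := P 2%N; have := P 3%N.
by rewrite !(coefD, coefCM, coefC, coefX, coefXn) /= !(mulr0, mulr1, add0r, addr0) => -> -> -> ->.
Qed.

Lemma sum_bool_le_exists (T : finType) (b : pred T) :
  (forall s t, b s -> b t -> s = t) -> (\sum_t b t <= [exists t, b t])%N.
Proof.
move=> buniq; have [/existsP[t bt]|/existsPn nb] := boolP [exists t, b t].
  rewrite (bigD1 t) //= bt big1 // => s st.
  by apply/eqP; rewrite eqb0; apply: contra_neqN st => bs; apply: buniq.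
by rewrite big1 // => t _; apply/eqP; rewrite eqb0.
Qed.

Lemma card_set_sum (T : finType) (b : pred T) : #|[set t | b t]| = (\sum_t b t)%N.
Proof.
by rewrite -sum1dep_card [RHS](eq_bigr (fun t => if b t then 1 else 0)%N) -?big_mkcond //.
Qed.

Lemma exists_sqrt_ceil (N : nat) : (0 < N)%N -> exists D, (N <= D ^ 2 <= 4 * N)%N.
Proof.
move=> N0; have ex : exists D, (N <= D ^ 2)%N by exists N; rewrite -mulnn leq_pmulr.
case: (ex_minnP ex) => -[|D] ND Dmin; first by lia.
exists D.+1; rewrite ND /=; case: D ND Dmin => [|D] ND Dmin; first by lia.
have lt : (D.+1 ^ 2 < N)%N by rewrite ltnNge; apply/negP => /Dmin; rewrite ltnn.
by nia.
Qed.

(** * Rays attached to pairs (line, abscissa) *)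

Section RayForm.
Variable K : fieldType.
Implicit Types r s : K * K * K.

(* Two rays with different directions meet if and only if this symplectic form
   vanishes. *)
Definition ray_form r s := r.2 - s.2 - r.1.1 * s.1.2 + s.1.1 * r.1.2.

Lemma common_point_ray_form x r s : r.1.2 - r.1.1 * x = s.1.2 - s.1.1 * x ->
  r.2 - r.1.1 * r.1.2 + r.1.1 ^+ 2 * x = s.2 - s.1.1 * s.1.2 + s.1.1 ^+ 2 * x ->
  ray_form r s = 0.
Proof.
case: r => [[a b] c]; case: s => [[a' b'] c'] /= /eqP; rewrite subr_eq => /eqP-> /eqP.
rewrite -subr_eq0 => /eqP E; rewrite /ray_form /= -[RHS]E; ring.
Qed.

Lemma ray_form0_meet r s : r.1.1 != s.1.1 -> ray_form r s = 0 ->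
  meet_at ((r.1.2 - s.1.2) / (r.1.1 - s.1.1)) r s.
Proof.
case: r => [[a b] c]; case: s => [[a' b'] c'] /= ne; rewrite /ray_form /= => E.
have d0 : a - a' != 0 by rewrite subr_eq0.
set x := _ / _; have xE : (a - a') * x = b - b' by rewrite /x mulrC divfK.
split=> //=.
  apply/eqP; rewrite -subr_eq0 [X in X == 0](_ : _ = b - b' - (a - a') * x); last by ring.
  by rewrite xE subrr.
apply/eqP; rewrite -subr_eq0.
rewrite [X in X == 0](_ : _ = c - c' - a * b + a' * b' + (a + a') * ((a - a') * x)); last by ring.
by rewrite xE -[X in _ == X]E; apply/eqP; ring.
Qed.

End RayForm.

Section LineRays.
Variables (F K : fieldType) (phi : {rmorphism F -> K}) (th : K).
Hypothesis generic : forall a b c d : F,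
  phi a + phi b * th + phi c * th ^+ 2 + phi d * th ^+ 3 = 0 ->
  [/\ a = 0, b = 0, c = 0 & d = 0].
Implicit Types (l : F * F) (x y : F).

Definition line_at l x : F := l.1 * x + l.2.

(** The powers of [th] cancel in the form of a left and a right ray, while they separate the
    coordinates of two rays on the same side. The second component of a pair is the abscissa at
    which the other line is evaluated. *)
Definition left_ray l y : K * K * K :=
  (phi l.1, th * phi y, - phi l.2 - th ^+ 2 * phi y - th ^+ 3 * phi l.1).

Definition right_ray l x : K * K * K := (phi l.1 / th + th, phi x - th ^+ 3, - phi l.2).

Lemma th_neq0 : th != 0.
Proof.
apply/eqP => t0; have [] := @generic 0 1 0 0; last by move=> _ /eqP; rewrite oner_eq0.
by rewrite t0 !rmorph0 mulr0 !expr0n /= !mulr0 !addr0.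
Qed.

Lemma left_right_dir l y l' x : (left_ray l y).1.1 != (right_ray l' x).1.1.
Proof.
apply/eqP => /= E; have [] := @generic l'.1 (- l.1) 1 0; last first.
  by move=> _ _ /eqP; rewrite oner_eq0.
rewrite rmorphN rmorph1 rmorph0 E; field; exact: th_neq0.
Qed.

Lemma left_right_form l y l' x :
  ray_form (left_ray l y) (right_ray l' x) = phi (line_at l' y - line_at l x).
Proof.
rewrite /ray_form /left_ray /right_ray /line_at /= rmorphB !rmorphD !rmorphM.
by field; exact: th_neq0.
Qed.

(** Expanded in powers of [th], the form has the differences of intercepts, abscissae and slopes
    among its coefficients. *)
Lemma left_left_form l y l' y' :
  ray_form (left_ray l y) (left_ray l' y') = 0 -> (l, y) = (l', y').
Proof.
case: l l' => [m c] [m' c'] E; have [] := @generic (c' - c) (m' * y - m * y') (y' - y) (m' - m).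
  by rewrite !rmorphB !rmorphM -[RHS]E /ray_form /left_ray /=; ring.
move=> /eqP; rewrite subr_eq0 => /eqP-> _ /eqP; rewrite subr_eq0 => /eqP->.
by move/eqP; rewrite subr_eq0 => /eqP->.
Qed.

Lemma right_right_form l x l' x' :
  ray_form (right_ray l x) (right_ray l' x') = 0 -> (l, x) = (l', x').
Proof.
case: l l' => [m c] [m' c'] E; have [] := @generic (m' * x - m * x') (c' - c) (x - x') (m - m').
  (* A factor [th] clears the denominator in the direction of a right ray. *)
  rewrite !rmorphB !rmorphM -[RHS](mulr0 th) -[in RHS]E /ray_form /right_ray /=.
  by field; exact: th_neq0.
move=> _ /eqP; rewrite subr_eq0 => /eqP-> /eqP; rewrite subr_eq0 => /eqP->.
by move/eqP; rewrite subr_eq0 => /eqP->.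
Qed.

Lemma ray_form_sym (r s : K * K * K) : ray_form r s = - ray_form s r.
Proof. by rewrite /ray_form; ring. Qed.

End LineRays.

(** * Incidences in a grid and the crossing graph *)

Section RichLines.
Variables (F : fieldType) (U V : {fset F}) (L : {fset F * F}) (k : nat).
Hypothesis rich : forall l : L, (k <= #|[set x : U | line_at (val l) (val x) \in V]|)%N.

(** Each of these lines keeps at least [k - 1] grid points off the abscissa [x0], and two different
    lines through [(x0, y0)] share none of them. *)
Lemma concurrent_rich_lines (x0 y0 : F) :
  (#|[set l : L | line_at (val l) x0 == y0]| * k.-1 <= #|` U| * #|` V|)%N.
Proof.
set P := [set l : L | _].
have rich' (l : L) : (k.-1 <= \sum_(x : U) \sum_(v : V)
    ((val x != x0) && (line_at (val l) (val x) == val v)))%N.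
  have := rich l; rewrite card_set_sum => kl.
  suff : (k <= \sum_(x : U) \sum_(v : V)
    ((val x != x0) && (line_at (val l) (val x) == val v)) + 1)%N by lia.
  apply: (leq_trans kl).
  have one : (\sum_(x : U) (val x == x0) <= 1)%N.
    apply: leq_trans (sum_bool_le_exists _) _; last by case: [exists _, _].
    by move=> s t /eqP es /eqP et; apply: val_inj; rewrite es.
  apply: leq_trans (leq_add (leqnn _) one); rewrite -big_split; apply: leq_sum => x _ /=.
  case: (boolP (line_at _ _ \in V)) => // lV; case: eqP => //= xx0; last first.
    by rewrite addn0 (bigD1 [` lV]%fset) //= eqxx.
  by rewrite addn1.
rewrite -sum_nat_const; apply: leq_trans (leq_sum _ (fun l _ => rich' l)) _.
rewrite exchange_big /= [leqRHS](_ : _ = \sum_(x : U) \sum_(v : V) 1)%N; last first.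
  by rewrite !sum_nat_const !cardfE muln1.
apply: leq_sum => x _; rewrite exchange_big /=; apply: leq_sum => v _.
rewrite big_mkcond /=.
rewrite (eq_bigr (fun l : L => nat_of_bool
    [&& l \in P, val x != x0 & line_at (val l) (val x) == val v]))
  => [|l _]; last by case: (l \in P).
apply: leq_trans (sum_bool_le_exists _) _; last by case: [exists _, _].
move=> l l'; rewrite !inE => /and3P[/eqP e0 ne /eqP e1] /and3P[/eqP e0' _ /eqP e1'].
apply: val_inj; move: e0 e1 e0' e1'; case: (val l) (val l') => [m c] [m' c'].
rewrite /line_at /= => <- <- e0 e1.
have mE : m = m'.
  have : (m - m') * (val x - x0) = 0.
    have -> : (m - m') * (val x - x0) =
      (m * val x + c - (m' * val x + c')) - (m * x0 + c - (m' * x0 + c')) by ring.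
    by rewrite e0 e1 !subrr.
  by move/eqP; rewrite mulf_eq0 !subr_eq0 (negPf ne) orbF => /eqP.
by congr pair => //; move: e0; rewrite mE => /addrI.
Qed.

Let T := (L * U)%type.
(** Abscissae are exchanged: [(l, y)] meets [(l', x)] when [l x = l' y], in accordance with
    [left_right_form]. *)
Definition meets (s t : T) : bool :=
  (line_at (val s.1) (val t.2) == line_at (val t.1) (val s.2))
    && (line_at (val s.1) (val t.2) \in V).

Let P (t : T) (v : V) := line_at (val t.1) (val t.2) == val v.

(** Cauchy-Schwarz, applied to the incidences sorted by their ordinate in [V]. *)
Lemma rich_lines_energy :
  ((#|` L| * k) ^ 2 <= #|` V| * \sum_(s : T) \sum_(t : T)
    meets s t)%N.
Proof.
pose J v := (\sum_(t : T) P t v)%N.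
have JE : (#|` L| * k <= \sum_(v : V) J v)%N.
  rewrite exchange_big /= -(pair_bigA _ (fun l x => \sum_(v : V) P (l, x) v))%N /=.
  rewrite cardfE -sum_nat_const; apply: leq_sum => l _.
  apply: (leq_trans (rich l)); rewrite card_set_sum; apply: leq_sum => x _.
  by case: (boolP (line_at _ _ \in V)) => // lV; rewrite (bigD1 [` lV]%fset) //= /P eqxx.
apply: (@leq_trans ((\sum_(v : V) J v) ^ 2)%N); first by rewrite leq_exp2r.
apply: (leq_trans (sum_sqr_ge _)); rewrite -cardfE leq_mul2l; apply/orP; right.
have -> : (\sum_(v : V) J v ^ 2 = \sum_(q : T * T) \sum_(v : V) (P q.1 v && P q.2 v))%N.
  rewrite exchange_big /=; apply: eq_bigr => v _; rewrite -mulnn big_distrlr /= pair_bigA /=.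
  by apply: eq_bigr => q _; case: (P q.1 v); case: (P q.2 v).
(* Exchanging abscissae turns two incidences of equal ordinate into a pair satisfying [meets]. *)
pose h (q : T * T) : T * T := ((q.1.1, q.2.2), (q.2.1, q.1.2)).
have hK : involutive h by move=> [[l y] [l' x]].
rewrite (reindex_inj (inv_inj hK)) /= [leqRHS]pair_bigA /=; apply: leq_sum => q _.
apply: leq_trans (sum_bool_le_exists _) _.
  by move=> v v' /andP[/eqP e _] /andP[/eqP e' _]; apply: val_inj; rewrite -e -e'.
case: existsP => [[v /andP[/eqP e /eqP e']]|//].
by rewrite /P /= in e e'; rewrite /meets e e' eqxx /= fsvalP.
Qed.

Let I := (T + T)%type.

Definition line_adj (i j : I) : bool :=
  match i, j with
  | inl s, inr t => meets s t
  | inr t, inl s => meets s t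
  | _, _ => false
  end.

Lemma line_adj_sym : ssrbool.symmetric line_adj.
Proof. by move=> [s|t] [s'|t']. Qed.

Lemma sum_line_adj : (\sum_(i : I) #|[set j | line_adj i j]| =
  2 * \sum_(s : T) \sum_(t : T) meets s t)%N.
Proof.
rewrite (eq_bigr (fun i => \sum_j line_adj i j)%N) => [|i _]; last by rewrite card_set_sum.
rewrite big_sumType /= mul2n -addnn; congr (_ + _)%N.
  by apply: eq_bigr => s _; rewrite big_sumType /= big1_eq add0n.
rewrite [RHS]exchange_big /=; apply: eq_bigr => t _.
by rewrite big_sumType /= big1_eq addn0.
Qed.

Section Rays.
Variables (K : fieldType) (phi : {rmorphism F -> K}) (th : K).
Hypothesis generic : forall a b c d : F,
  phi a + phi b * th + phi c * th ^+ 2 + phi d * th ^+ 3 = 0 ->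
  [/\ a = 0, b = 0, c = 0 & d = 0].

Definition line_ray (i : I) : K * K * K :=
  match i with
  | inl s => left_ray phi th (val s.1) (val s.2)
  | inr t => right_ray phi th (val t.1) (val t.2)
  end.

Definition cross_pt (i j : I) : K :=
  ((line_ray i).1.2 - (line_ray j).1.2) / ((line_ray i).1.1 - (line_ray j).1.1).

Lemma line_adj_meet i j : line_adj i j -> meet_at (cross_pt i j) (line_ray i) (line_ray j).
Proof.
move=> ij; apply: ray_form0_meet.
  case: i j ij => [s|t] [s'|t'] // _; first exact: (left_right_dir generic).
  by rewrite eq_sym; apply: (left_right_dir generic).
case: i j ij => [s|t] [s'|t'] // /andP[/eqP e _]; last rewrite ray_form_sym.
  by rewrite (left_right_form generic) e subrr rmorph0.
by rewrite (left_right_form generic) e subrr rmorph0 oppr0.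
Qed.

(** Two neighbours that cross ray [i] at the same point belong to the same family and have a common
    point, so genericity identifies them. *)
Lemma cross_pt_inj i j j' : line_adj i j -> line_adj i j' ->
  cross_pt i j = cross_pt i j' -> j = j'.
Proof.
move=> ij ij' E; have [_ e1 e2] := line_adj_meet ij.
have [_] := line_adj_meet ij'; rewrite -E e1 e2 => e1' e2'.
have := common_point_ray_form e1' e2'.
have tE (s t : T) : (val s.1, val s.2) = (val t.1, val t.2) -> s = t.
  by case: s t => [l x] [l' x'] /= [] /val_inj -> /val_inj ->.
case: i j j' ij ij' {E e1 e2 e1' e2'} => [s|t] [s1|t1] [s2|t2] //= _ _.
  by move/(right_right_form generic)/tE->.
by move/(left_left_form generic)/tE->.
Qed.

Variable c : nat.
Hypothesis concur : forall x0 y0, (#|[set l : L | line_at (val l) x0 == y0]| <= c)%N.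

(** If [be] is nonzero, the abscissa determines the slope, and then the value at [x0] determines the
    line. If [be] is zero, the abscissa is constant and all lines pass through one point. *)
Lemma collinear_rays_bound (J : {set T}) (ka be al ga b0 a0 : K) (x0 : F) (psi : F -> F) :
  al != 0 -> ga != 0 ->
  {in J, forall t, line_at (val t.1) x0 = psi (val t.2)} ->
  {in J, forall t, ka * (al * phi (val t.2) + b0) + be * (ga * phi (val t.1).1 + a0) = 1} ->
  (#|J| <= maxn #|` U| c)%N.
Proof.
move=> al0 ga0 Jl JE; have [->|/set0Pn[t0 t0J]] := eqVneq J set0; first by rewrite cards0.
rewrite leq_max; have [be0|be0] := eqVneq be 0; last first.
  apply/orP; left; rewrite cardfE -(card_in_imset (f := snd) (D := J)) ?max_card //.
  move=> [l x] [l' x'] tJ t'J /= xx; rewrite -xx in t'J *; congr pair.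
  have := JE _ tJ; rewrite -(JE _ t'J) /= => /addrI/(mulfI be0)/addIr/(mulfI ga0)/fmorph_inj mm.
  have := Jl _ tJ; rewrite -(Jl _ t'J) /= /line_at mm => /addrI cc.
  by apply: val_inj; rewrite [LHS]surjective_pairing [RHS]surjective_pairing mm cc.
apply/orP; right; apply: leq_trans (concur x0 (psi (val t0.2))).
have x0E t : t \in J -> t.2 = t0.2.
  move=> tJ; have E0 := JE _ t0J.
  have := etrans (JE _ tJ) (esym E0); rewrite be0 !mul0r !addr0 => E.
  have ka0 : ka != 0.
    by apply: contra_eq_neq E0 => ->; rewrite be0 !mul0r addr0 eq_sym oner_neq0.
  by apply/val_inj; move: E => /(mulfI ka0)/addIr/(mulfI al0)/fmorph_inj.
rewrite -(card_in_imset (f := fst) (D := J)).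
  apply/subset_leq_card/subsetP => _ /imsetP[t tJ ->]; rewrite inE (Jl _ tJ).
  by rewrite (x0E _ tJ).
by move=> [l x] [l' x'] tJ t'J /= ->; rewrite (x0E _ tJ : x = _) (x0E _ t'J : x' = _).
Qed.

Lemma collinear_neighbours_bound i (J : {set I}) (ka be : K) :
  {in J, forall j, line_adj i j} ->
  {in J, forall j, ka * ((line_ray j).1.2 - (line_ray i).1.2)
    + be * ((line_ray j).1.1 - (line_ray i).1.1) = 1} ->
  (#|J| <= maxn #|` U| c)%N.
Proof.
have th0 := th_neq0 generic.
case: i => [s|t] Jadj JE.
  (* All neighbours lie in the other family, so the default value [s] is never taken. *)
  rewrite -(card_in_imset (f := fun j : I => if j is inr t then t else s) (D := J)); last first.
    by move=> [j|j] [j'|j'] /Jadj // _ /Jadj // _ /= ->.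
  apply: (@collinear_rays_bound _ ka be 1 th^-1 (- th ^+ 3 - (line_ray (inl s)).1.2)
    (th - (line_ray (inl s)).1.1) (val s.2) (line_at (val s.1))); rewrite ?oner_neq0 ?invr_eq0 //.
    by move=> _ /imsetP[[j|j] /Jadj // /andP[/eqP e _] ->].
  move=> _ /imsetP[[j /Jadj //|j jJ ->]]; rewrite -[RHS](JE _ jJ) /=; ring.
rewrite -(card_in_imset (f := fun j : I => if j is inl s then s else t) (D := J)); last first.
  by move=> [j|j] [j'|j'] /Jadj // _ /Jadj // _ /= ->.
apply: (@collinear_rays_bound _ ka be th 1 (- (line_ray (inr t)).1.2)
  (- (line_ray (inr t)).1.1) (val t.2) (line_at (val t.1))); rewrite ?oner_neq0 //.
  by move=> _ /imsetP[[j|j] /Jadj // /andP[/eqP e _] ->].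
move=> _ /imsetP[[j jJ ->|j /Jadj //]]; rewrite -[RHS](JE _ jJ) /=; ring.
Qed.

End Rays.

End RichLines.

(** Each of the four summands is compared with [X = m * k ^ 2]. From [k <= n] one gets
    [C * n ^ 3 < X] and [C * n ^ 4 < X * k]; the summand with [D] is compared after squaring. *)
Lemma rich_lines_arith (C n m k D : nat) : (1000 * 400 <= C)%N ->
  (1 < k <= n)%N -> (D ^ 2 <= 24 * (m * n))%N ->
  (C * n ^ 5 < m * k ^ 4)%N ->
  (2 * (15 * D + n + n ^ 2 %/ k.-1 + 1) * n ^ 2 < m * k ^ 2)%N.
Proof.
move=> CC /andP[k1 kn] DD big; set q := (n ^ 2 %/ k.-1)%N; set X := (m * k ^ 2)%N.
have n0 : (1 < n)%N by lia.
have Xk : (C * n ^ 5 < X * k ^ 2)%N by rewrite /X -mulnA -expnD.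
have X3 : (C * n ^ 3 < X)%N.
  rewrite ltnNge; apply/negP => XE; move: Xk; rewrite ltnNge => /negP; apply.
  by rewrite (_ : 5 = 3 + 2)%N // expnD mulnA leq_mul // leq_exp2r.
have Xk1 : (C * n ^ 4 < X * k)%N.
  rewrite ltnNge; apply/negP => XE; move: Xk; rewrite ltnNge => /negP; apply.
  by rewrite -mulnn (mulnA X) (_ : 5 = 4 + 1)%N // expnD expn1 (mulnA C) leq_mul.
have qk : (q * k <= 2 * n ^ 2)%N.
  have := leq_trunc_div (n ^ 2) k.-1; rewrite -/q => qE.
  by apply: (@leq_trans (2 * (q * k.-1))); [nia|rewrite leq_mul2l].
have T2 : (C * (n ^ 2 * q) < 2 * X)%N.
  rewrite -(ltn_pmul2r (_ : 0 < k)%N); last by lia.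
  apply: (@leq_ltn_trans (2 * (C * n ^ 4))); last by rewrite -mulnA ltn_pmul2l.
  have -> : (2 * (C * n ^ 4) = C * (n ^ 2 * (2 * n ^ 2)))%N.
    by rewrite (_ : 4 = 2 + 2)%N // expnD mulnCA (mulnCA (n ^ 2)%N 2).
  by rewrite -!mulnA !leq_mul2l qk !orbT.
(* The numerical margin: [120 ^ 2 * 24 = 345600] is below [1000 * 400]. *)
have T1 : (4 * (30 * (D * n ^ 2)) < X)%N.
  have E : ((4 * (30 * (D * n ^ 2))) ^ 2 = 4 ^ 2 * (30 ^ 2 * (D ^ 2 * n ^ 4)))%N.
    by rewrite (expnMn 4) (expnMn 30) (expnMn D) -expnM.
  rewrite -(@ltn_exp2r _ _ 2) // E.
  have X2 : (C * (m * n ^ 5) <= X ^ 2)%N.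
    by rewrite /X expnMn -expnM -mulnn -mulnA mulnCA leq_mul2l ltnW // orbT.
  have m0 : (0 < m)%N by move: big; case: (m).
  have D4 : (D ^ 2 * n ^ 4 <= 24 * (m * n ^ 5))%N.
    by apply: leq_trans (leq_mul DD (leqnn _)) _; rewrite -mulnA leq_mul2l /= -mulnA -expnS.
  have e0 : (0 < m * n ^ 5)%N by rewrite muln_gt0 m0 expn_gt0; lia.
  have := leq_trans (leq_mul CC (leqnn (m * n ^ 5)%N)) X2.
  move: (X ^ 2)%N (D ^ 2 * n ^ 4)%N (m * n ^ 5)%N D4 e0 => x d e; clear; lia.
have T3 : (1000 * 400 * n ^ 3 < X)%N by apply: leq_ltn_trans X3; rewrite leq_mul2r CC orbT.
have T4 : (n ^ 2 <= n ^ 3)%N by rewrite leq_exp2l.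
have T2' : (1000 * 400 * (n ^ 2 * q) < 2 * X)%N.
  by apply: leq_ltn_trans T2; rewrite leq_mul2r CC orbT.
have -> : (2 * (15 * D + n + q + 1) * n ^ 2 =
  30 * (D * n ^ 2) + 2 * n ^ 3 + 2 * (n ^ 2 * q) + 2 * n ^ 2)%N.
  by rewrite [(n ^ 3)%N]expnS; move: (n ^ 2)%N => a; nia.
move: T1 T2' T3 T4; move: (n ^ 3)%N (n ^ 2 * q)%N (D * n ^ 2)%N (n ^ 2)%N => a b d e.
by clear; lia.
Qed.

(** If the bound failed, the crossing graph would have a subgraph of large minimum degree, in which
    [crossing_rays_theorem] yields more collinear neighbours than [collinear_neighbours_bound]
    allows. *)
Theorem rich_lines_bound : exists C : nat,
  forall (F : fieldType) (p : nat) (U V : {fset F}) (L : {fset F * F}) (n k : nat),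
  p \in [pchar F] -> (#|` U| <= n)%N -> (#|` V| <= n)%N -> (1 < k)%N ->
  (forall l : L, (k <= #|[set x : U | line_at (val l) (val x) \in V]|)%N) ->
  (864 * (n * #|` L|) <= p ^ 2)%N -> (#|` L| * k ^ 4 <= C * n ^ 5)%N.
Proof.
have [C CC] : exists C, (1000 * 400 <= C)%N by exists (1000 * 400)%N; apply: leqnn.
exists C => F p U V L n k charF Un Vn k1 rich Lp; rewrite leqNgt; apply/negP => big.
set m := #|` L| in Lp big.
have m0 : (0 < m)%N by move: big; case: (m).
have kU : (k <= #|` U|)%N.
  have : (0 < #|{: L}|)%N by rewrite -cardfE.
  case/card_gt0P => l _; rewrite (leq_trans (rich l)) // cardfE.
  by rewrite (leq_trans (max_card _)).
have kn := leq_trans kU Un; have n0 : (0 < n)%N by lia.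
(* There are at most [2 * (m * n)] rays, so [6 * (m * n) <= D ^ 2] allows the vanishing polynomial;
   [D ^ 2 <= 24 * (m * n)] gives [6 * D <= p] since [36 * 24 = 864]. *)
have [|D /andP[D6 D24]] := @exists_sqrt_ceil (6 * (m * n)).
  by rewrite !muln_gt0 m0 n0.
have Dp : (6 * D <= p)%N.
  rewrite -(@leq_exp2r _ _ 2) // expnMn; apply: leq_trans Lp.
  by move: D24; rewrite (mulnC n); lia.
have D24' : (D ^ 2 <= 24 * (m * n))%N by apply: leq_trans D24 _; lia.
have ar := @rich_lines_arith C n m k D CC (introT andP (conj k1 kn)) D24' big.
set q := (n ^ 2 %/ k.-1)%N in ar.
(* The degree must exceed [15 * D] and, after the loss of [3 * D - 3] neighbours, still exceed the
   collinear bound [n + q]. *)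
pose d := (15 * D + n + q + 1)%N.
have concur x0 y0 : (#|[set l : L | line_at (val l) x0 == y0]| <= q)%N.
  rewrite leq_divRL; last by lia.
  by rewrite (leq_trans (concurrent_rich_lines rich x0 y0)) // -mulnn leq_mul.
have [Z [Z0 Zd]] : exists Z : {set (L * U) + (L * U)}, Z != set0 /\
    forall i, i \in Z -> (d <= #|[set j in Z | line_adj V i j]|)%N.
  apply: min_degree_subgraph; first exact: line_adj_sym.
  rewrite sum_line_adj card_sum card_prod -!cardfE -/m.
  have en := rich_lines_energy rich.
  have Vn' := leq_trans en (leq_mul Vn (leqnn _)); move: Vn'; rewrite -/m.
  set S := (\sum_(s : _) \sum_(t : _) _)%N => Vn'.
  have nn : (n * (2 * d * (m * n)) < n * S)%N.
    apply: leq_trans Vn'; rewrite expnMn -(mulnn m) -(mulnA m m).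
    rewrite (_ : n * (2 * d * (m * n)) = m * (2 * d * n ^ 2))%N; last by rewrite -mulnn; nia.
    by rewrite ltn_pmul2l.
  rewrite ltn_pmul2l // in nn.
  apply: (@leq_ltn_trans (2 * (2 * d * (m * n)))); last by rewrite ltn_pmul2l.
  by rewrite addnn -mul2n mulnCA !leq_mul2l Un !orbT.
have [K [phi [th gen]]] := exists_generic F.
pose I : finType := {i : (L * U) + (L * U) | i \in Z}.
pose r (i : I) := line_ray phi th (val i).
pose N (i : I) : {set I} := [set j : I | line_adj V (val i) (val j)].
have NE (i : I) : (d <= #|N i|)%N.
  rewrite (leq_trans (Zd _ (valP i))) // -(card_imset (N i) val_inj).
  apply/subset_leq_card/subsetP => j; rewrite inE => /andP[jZ ij].
  by apply/imsetP; exists (exist _ j jZ); rewrite ?inE.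
have [i0 i0Z] := set0Pn _ Z0.
have [] := @crossing_rays_theorem K I r N (fun i j => cross_pt phi th (val i) (val j)) D p.
- by move=> i j; rewrite inE; apply: line_adj_meet.
- move=> i j j'; rewrite !inE => ij ij' E; apply: val_inj.
  exact: (cross_pt_inj gen ij ij' E).
- by move=> i; apply: leq_trans (NE i); rewrite /d; lia.
- by rewrite (rmorph_pchar phi).
- by [].
- exact: (exist _ i0 i0Z).
- have IE : (#|{: I}| <= 2 * (m * n))%N.
    rewrite card_sig (leq_trans (max_card _)) // card_sum card_prod -!cardfE -/m.
    by rewrite addnn -mul2n !leq_mul2l Un !orbT.
  apply: leq_ltn_trans (leq_mul IE (leqnn _)) _.
  have D0 : (0 < D)%N.
    by rewrite lt0n; apply: contraTneq D6 => ->; rewrite -ltnNge !muln_gt0 m0 n0.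
  have := muln_gt0 m n; rewrite m0 n0 /= => mn0.
  apply: (@leq_trans (D * (6 * (m * n)))); last by rewrite expnS leq_mul2l D6 orbT.
  by move: (m * n)%N mn0 D0 => b b0 D0; clear - b0 D0; nia.
move=> i [J [ka [be [JN NJ JE]]]].
have JJ : (#|J| <= maxn #|` U| q)%N.
  rewrite -(card_imset J val_inj).
  apply: (collinear_neighbours_bound gen concur (V := V) (i := val i) (ka := ka) (be := be)).
    by move=> _ /imsetP[j jJ ->]; have := subsetP JN _ jJ; rewrite inE.
  by move=> _ /imsetP[j jJ ->]; exact: (JE _ jJ).
have := leq_trans (NE i) NJ; have : (#|J| <= n + q)%N.
  by apply: leq_trans JJ _; rewrite geq_max leq_addl (leq_trans Un) ?leq_addr.
by rewrite /d; lia.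
Qed.

(** * Growth of sums and of sums of inverses *)

Lemma leq_card_fset_inj (T : finType) (K : choiceType) (R : {set T}) (f : T -> K)
    (U : {fset K}) (Q : pred K) :
  {in R &, injective f} -> {in R, forall t, (f t \in U) && Q (f t)} ->
  (#|R| <= #|[set x : U | Q (val x)]|)%N.
Proof.
move=> finj fU; pose g t : option U := insub (f t).
have gE t : t \in R -> exists2 x : U, g t = Some x & val x = f t.
  by move=> /fU/andP[tU _]; exists [` tU]%fset; rewrite // /g insubT.
have ginj : {in R &, injective g}.
  move=> s t sR tR; have [x gx xE] := gE _ sR; have [y gy yE] := gE _ tR.
  by rewrite gx gy => -[xy]; apply: finj => //; rewrite -xE -yE xy.
have Sinj : injective (@Some U) by move=> a b [].
rewrite -(card_in_imset ginj) -(card_imset _ Sinj).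
apply/subset_leq_card/subsetP => _ /imsetP[t tR ->].
have [x -> xE] := gE _ tR; apply: imset_f; rewrite inE xE.
by have /andP[] := fU _ tR.
Qed.

Lemma leq_card_fibres (T : finType) (K : choiceType) (B : {set T}) (f : T -> K)
    (S : {fset K}) : {in B, forall t, f t \in S} ->
  (#|B| <= \sum_(s : S) #|[set t in B | f t == val s]|)%N.
Proof.
move=> fS; under eq_bigr do rewrite card_set_sum.
rewrite exchange_big /= -sum1_card big_mkcond /=; apply: leq_sum => t _.
case: ifP => // tB; rewrite (bigD1 [` fS _ tB]%fset) //= eqxx.
by [].
Qed.

Lemma exists_fsubset_card (K : choiceType) (L : {fset K}) (m : nat) :
  (m <= #|` L|)%N -> exists2 L0 : {fset K}, (L0 `<=` L)%fset & #|` L0| = m.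
Proof.
move=> mL; exists [fset x in take m (enum_fset L)]%fset.
  by apply/fsubsetP => x; rewrite !inE => /mem_take.
by rewrite card_fseq undup_id ?take_uniq ?fset_uniq // size_takel.
Qed.

(** The sides of the grid: for [u = t - 1 / a + 1 / b] the element is [1 / (1 / b - 1 / a)]. *)
Definition inv_shift (F : fieldType) (t : F) (T : {fset F}) : {fset F} :=
  [fset (u - t)^-1 | u in T]%fset.

Section Growth.
Variables (F : fieldType) (A1 A2 Y1 Y2 S T1 T2 : {fset F}) (N n : nat).
Hypotheses (A10 : 0 \notin A1) (A20 : 0 \notin A2).
Hypotheses (A1N : #|` A1| = N) (A2N : #|` A2| = N) (Y1N : #|` Y1| = N) (Y2N : #|` Y2| = N).
Hypotheses (Sn : (#|` S| <= n)%N) (T1n : (#|` T1| <= n)%N) (T2n : (#|` T2| <= n)%N).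
Hypothesis SE : forall a a', a \in A1 -> a' \in A2 -> a + a' \in S.
Hypothesis T1E : forall y a, y \in Y1 -> a \in A1 -> y + a^-1 \in T1.
Hypothesis T2E : forall y a, y \in Y2 -> a \in A2 -> y + a^-1 \in T2.

Local Notation P2 := (A1 * A2)%type.

Definition pair_sum (q : P2) : F := val q.1 + val q.2.

Definition sum_reps (s : F) : nat := #|[set a : A1 | s - val a \in A2]|.

Definition popular_pairs : {set P2} :=
  [set q | (pair_sum q != 0) && (N ^ 2 <= 4 * n * sum_reps (pair_sum q))%N].

Let card_sum_fibre s : (#|[set q : P2 | pair_sum q == s]| <= sum_reps s)%N.
Proof.
rewrite -(card_in_imset (f := fst)) => [|[a b] [a' b']]; last first.
  rewrite !inE /pair_sum /= => /eqP e /eqP e' aa; rewrite aa in e *.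
  by congr pair; apply/val_inj/(addrI (val a')); rewrite e e'.
apply/subset_leq_card/subsetP => _ /imsetP[[a b] + ->]; rewrite !inE /pair_sum /= => /eqP <-.
by rewrite addrC addKr fsvalP.
Qed.

(** Each of the at most [n] unpopular sums has fewer than [N ^ 2 / (4 * n)] representations, which
    makes at most [N ^ 2 / 4] pairs; at most [N <= N ^ 2 / 4] pairs have sum zero. *)
Lemma card_popular_pairs : (4 <= N)%N -> (N ^ 2 <= 2 * #|popular_pairs|)%N.
Proof.
move=> N4; have r_le s : (sum_reps s <= N)%N by rewrite /sum_reps (leq_trans (max_card _)) // -cardfE A1N.
pose B := [set q : P2 | (4 * n * sum_reps (pair_sum q) < N ^ 2)%N].
have cB : (4 * #|B| <= N ^ 2)%N.
  have n0 : (0 < n)%N.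
    have : (0 < #|{: A1}|)%N by rewrite -cardfE A1N; lia.
    have : (0 < #|{: A2}|)%N by rewrite -cardfE A2N; lia.
    case/card_gt0P => b _ /card_gt0P[a _]; apply: leq_trans Sn.
    by rewrite cardfE; apply/card_gt0P; exists [` SE (fsvalP a) (fsvalP b)]%fset.
  rewrite -(leq_pmul2l n0) mulnA (mulnC n).
  have := @leq_card_fibres _ _ B pair_sum S (fun q _ => SE (fsvalP q.1) (fsvalP q.2)).
  rewrite -(leq_pmul2l (_ : 0 < 4 * n)%N) ?muln_gt0 // => /leq_trans; apply.
  apply: (@leq_trans (\sum_(s : S) N ^ 2)%N).
    rewrite big_distrr /=; apply: leq_sum => s _.
    have [->|[q]] := set_0Vmem [set t in B | pair_sum t == val s]; first by rewrite cards0 muln0.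
    rewrite inE => /andP[]; rewrite inE => qB /eqP qs; rewrite qs in qB.
    apply: leq_trans (ltnW qB); rewrite leq_mul2l; apply/orP; right.
    apply: leq_trans (card_sum_fibre _).
    by apply/subset_leq_card/subsetP => t; rewrite !inE => /andP[].
  by rewrite sum_nat_const -cardfE leq_mul2r Sn orbT.
have cC : (#|~: popular_pairs| <= N + #|B|)%N.
  apply: (@leq_trans (#|[set q : P2 | pair_sum q == 0] :|: B|)).
    apply/subset_leq_card/subsetP => q; rewrite !inE negb_and negbK -ltnNge.
    by [].
  apply: leq_trans (leq_card_setU _ _) _; rewrite leq_add2r.
  by rewrite (leq_trans (card_sum_fibre 0)).
have := cardsC popular_pairs; rewrite card_prod -!cardfE A1N A2N => cE.
by move: cB cC cE; rewrite -mulnn; nia.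
Qed.

Definition base_pairs (t1 t2 : F) : {set P2} :=
  [set q in popular_pairs | (t1 - (val q.1)^-1 \in Y1) && (t2 - (val q.2)^-1 \in Y2)].

(** Averaging over the at most [n ^ 2] pairs [(t1, t2)]: each popular pair is counted for at least
    [N ^ 2] of them, namely [t1] in [Y1 + 1 / a] and [t2] in [Y2 + 1 / a']. *)
Lemma exists_rich_base : (4 <= N)%N ->
  exists t1 t2, (N ^ 4 <= 2 * n ^ 2 * #|base_pairs t1 t2|)%N.
Proof.
move=> N4.
have card_base (q : P2) : (N ^ 2 <= \sum_(t : T1 * T2)
    ((val t.1 - (val q.1)^-1)%R \in Y1) && ((val t.2 - (val q.2)^-1)%R \in Y2))%N.
  have shift (Y T : {fset F}) (u : F) : (forall y, y \in Y -> y + u \in T) ->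
      (#|` Y| <= #|[set t : T | (val t - u)%R \in Y]|)%N.
    move=> YT; rewrite cardfE -cardsT.
    apply: (@leq_card_fset_inj _ _ setT (fun y : Y => val y + u) T (fun t => t - u \in Y)).
      by move=> y z _ _ /addIr/val_inj.
    by move=> y _; rewrite YT ?fsvalP //= addrK fsvalP.
  have S1 := shift Y1 T1 _ (fun y yY => T1E yY (fsvalP q.1)).
  have S2 := shift Y2 T2 _ (fun y yY => T2E yY (fsvalP q.2)).
  rewrite Y1N in S1; rewrite Y2N in S2.
  rewrite -mulnn (leq_trans (leq_mul S1 S2)) // !card_set_sum big_distrlr /= pair_bigA /=.
  by apply: leq_sum => t _; rewrite mulnb.
have tot : (#|popular_pairs| * N ^ 2 <= \sum_(t : T1 * T2) #|base_pairs (val t.1) (val t.2)|)%N.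
  under eq_bigr do rewrite card_set_sum.
  rewrite exchange_big /= -sum_nat_const big_mkcond /=; apply: leq_sum => q _.
  by case: ifP => // qP; apply: leq_trans (card_base q) _.
have [/existsP[t tP]|/existsPn none] :=
  boolP [exists t : T1 * T2, (N ^ 4 <= 2 * n ^ 2 * #|base_pairs (val t.1) (val t.2)|)%N].
  by exists (val t.1), (val t.2).
have pop := card_popular_pairs N4.
have N0 : (0 < N ^ 4)%N by rewrite expn_gt0; lia.
have le : (2 * n ^ 2 * \sum_(t : T1 * T2) #|base_pairs (val t.1) (val t.2)| <=
    n ^ 2 * (N ^ 4).-1)%N.
  rewrite big_distrr /= (@leq_trans (\sum_(t : T1 * T2) (N ^ 4).-1)%N) //.
    by apply: leq_sum => t _; rewrite -ltnS prednK // ltnNge none.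
  by rewrite sum_nat_const card_prod -!cardfE leq_mul2r -mulnn leq_mul ?orbT.
have ge : (n ^ 2 * N ^ 4 <= 2 * n ^ 2 * (#|popular_pairs| * N ^ 2))%N.
  by rewrite (_ : 4 = 2 + 2)%N // expnD mulnA mulnA leq_mul2r -mulnA mulnCA leq_mul2l pop !orbT.
have n0 : (0 < n ^ 2)%N.
  rewrite expn_gt0 lt0n; apply/orP; left; apply: contraTneq T1n => ->.
  rewrite -ltnNge cardfE.
  have : (0 < #|{: A1}|)%N by rewrite -cardfE A1N; lia.
  have : (0 < #|{: Y1}|)%N by rewrite -cardfE Y1N; lia.
  case/card_gt0P => y _ /card_gt0P[a _].
  by apply/card_gt0P; exists [` T1E (fsvalP y) (fsvalP a)]%fset.
have := leq_trans ge (leq_trans (leq_mul (leqnn _) tot) le).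
by rewrite leq_pmul2l // leqNgt prednK // leqnn.
Qed.

Section Base.
Variables t1 t2 : F.

Let slope (q : P2) := val q.2 / val q.1.

(* For [b + b' = a + a'], the point
   [(1 / (1 / b - 1 / a), 1 / (1 / b' - 1 / a'))] lies on the line [pair_line (a, a')]. *)
Definition pair_line (q : P2) : F * F := (- slope q ^+ 2, - (slope q * pair_sum q)).

Let val1_neq0 (a : A1) : val a != 0.
Proof. by apply: contraNneq A10 => <-; apply: fsvalP. Qed.

Let val2_neq0 (a : A2) : val a != 0.
Proof. by apply: contraNneq A20 => <-; apply: fsvalP. Qed.

(** Each representation [b + b'] of the sum gives a grid point on the line, except [b = a], where
    [1 / b - 1 / a] is zero; hence the [+ 1]. *)
Lemma pair_line_rich (q : P2) : q \in base_pairs t1 t2 ->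
  (sum_reps (pair_sum q) <= #|[set x : inv_shift t1 T1 |
    line_at (pair_line q) (val x) \in inv_shift t2 T2]| + 1)%N.
Proof.
rewrite inE => /and3P[_ q1 q2].
pose R := [set a : A1 | (pair_sum q - val a \in A2) && (val a != val q.1)].
apply: (@leq_trans (#|R| + 1)).
  rewrite /sum_reps (cardsD1 q.1) addnC leq_add ?leq_b1 //.
  by apply/subset_leq_card/subsetP => a; rewrite !inE => /andP[aq ->]; rewrite val_eqE.
rewrite leq_add2r.
apply: (@leq_card_fset_inj _ _ R (fun a => ((val a)^-1 - (val q.1)^-1)^-1) _
  (fun x => line_at (pair_line q) x \in inv_shift t2 T2)).
  by move=> a b _ _ /invr_inj/addIr/invr_inj/val_inj.
move=> a; rewrite inE => /andP[a2 aq]; apply/andP; split.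
  (* For a base pair [t1 - 1 / a] lies in [Y1], so this element lies in [T1]. *)
  apply/imfsetP; exists (t1 - (val q.1)^-1 + (val a)^-1); first exact: T1E (fsvalP a).
  by congr (_^-1); ring.
apply/imfsetP; exists (t2 - (val q.2)^-1 + (pair_sum q - val a)^-1); first exact: T2E.
have a'0 : pair_sum q - val a != 0 by apply: contraNneq A20 => <-.
have := val1_neq0 a; have := val1_neq0 q.1; have := val2_neq0 q.2.
move: aq a'0; rewrite /line_at /pair_line /slope /pair_sum /=.
move: (val a) (val q.1) (val q.2) => x b b' xb x'0 b'0 b0 x0.
have -> : t2 - b'^-1 + (b + b' - x)^-1 - t2 = (b + b' - x)^-1 - b'^-1 by ring.
field; rewrite x0 b0 b'0 x'0 /= [_ + -1 * (_ - x)](_ : _ = x - b); last by ring.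
by rewrite mulN1r !subr_eq0 xb eq_sym.
Qed.

(** The line determines the square of [slope q], thus [slope q] up to sign. The slope and the line
    give the sum, and since the sum is nonzero, also the pair. *)
Lemma card_base_lines :
  (#|base_pairs t1 t2| <= 2 * #|` [fset pair_line q | q in base_pairs t1 t2]%fset|)%N.
Proof.
set L := [fset _ | _ in _]%fset.
have lineL : {in base_pairs t1 t2, forall q, pair_line q \in L}.
  by move=> q qB; apply/imfsetP; exists q.
apply: leq_trans (leq_card_fibres lineL) _.
rewrite cardfE mulnC -sum_nat_const; apply: leq_sum => l _.
have slope_inj q q' : q \in base_pairs t1 t2 -> q' \in base_pairs t1 t2 ->
    pair_line q = pair_line q' -> slope q = slope q' -> q = q'.
  rewrite !inE => /and3P[/andP[s0 _] _ _] /and3P[/andP[s0' _] _ _] [_ e] ss.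
  have sl0 : slope q' != 0 by rewrite mulf_neq0 ?invr_eq0.
  have addE : pair_sum q = pair_sum q' by apply: (mulfI sl0); move/oppr_inj: e; rewrite ss.
  have addS (u : P2) : pair_sum u = (1 + slope u) * val u.1.
    by rewrite /pair_sum /slope mulrDl mul1r divfK.
  have S2 (u : P2) : val u.2 = slope u * val u.1 by rewrite /slope divfK.
  have q1 : val q.1 = val q'.1.
    have s1 : 1 + slope q' != 0 by apply: contraNneq s0' => s1; rewrite addS s1 mul0r.
    by apply: (mulfI s1); rewrite -{1}ss -!addS.
  have q2 : val q.2 = val q'.2 by rewrite !S2 ss q1.
  by rewrite (surjective_pairing q) (surjective_pairing q') (val_inj q1) (val_inj q2).
have [->|[q0]] := set_0Vmem [set q in base_pairs t1 t2 | pair_line q == val l].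
  by rewrite cards0.
case/setIdP => q0B /eqP q0l.
rewrite -(card_in_imset (f := fun q => slope q == slope q0)); first by rewrite -card_bool max_card.
move=> q q' /setIdP[qB /eqP ql] /setIdP[q'B /eqP q'l] /= ss.
have sqr u : pair_line u = val l -> (slope u == slope q0) || (slope u == - slope q0).
  by rewrite -q0l => -[/oppr_inj/eqP]; rewrite eqf_sqr.
apply: (slope_inj _ _ qB q'B (etrans ql (esym q'l))).
have := sqr _ ql; have := sqr _ q'l; move: ss; have [/eqP->|_] := boolP (slope q == slope q0).
  by move=> /esym/eqP->.
by move=> /esym-> /= /eqP-> /eqP->.
Qed.

End Base.

End Growth.

(** The sets are kept separate so that both inequalities are instances. At least
    [N ^ 4 / (4 * n ^ 2)] lines carry at least [N ^ 2 / (8 * n)] grid points each, which is played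
    against [rich_lines_bound]. *)
Theorem inversion_growth : exists C : nat,
  forall (F : fieldType) (p : nat) (A1 A2 Y1 Y2 S T1 T2 : {fset F}) (N n : nat),
  p \in [pchar F] -> 0 \notin A1 -> 0 \notin A2 ->
  #|` A1| = N -> #|` A2| = N -> #|` Y1| = N -> #|` Y2| = N ->
  (#|` S| <= n)%N -> (#|` T1| <= n)%N -> (#|` T2| <= n)%N ->
  (forall a a', a \in A1 -> a' \in A2 -> a + a' \in S) ->
  (forall y a, y \in Y1 -> a \in A1 -> y + a^-1 \in T1) ->
  (forall y a, y \in Y2 -> a \in A2 -> y + a^-1 \in T2) ->
  (N ^ 3 <= p ^ 2)%N -> (N ^ 12 <= C * n ^ 11)%N.
Proof.
have [C0 C0P] := rich_lines_bound.
have [e4 e4E] : exists e4, (e4 = 8 ^ 4)%N by exists (8 ^ 4)%N.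
pose c1 := (C0.+1 * e4)%N; pose c := (2 * c1)%N.
have [C CC] : exists C, (864 * c + 2 * c + 100 <= C)%N.
  by exists (864 * c + 2 * c + 100)%N; apply: leqnn.
exists C => F p A1 A2 Y1 Y2 S T1 T2 N n charF A10 A20 A1N A2N Y1N Y2N Sn T1n T2n SE T1E T2E Np.
rewrite leqNgt; apply/negP => big.
have c0 : (100 <= C)%N by apply: leq_trans CC; apply: leq_addl.
have Cc : (864 * c <= C)%N by apply: leq_trans CC; rewrite -addnA leq_addr.
have C2 : (2 * c <= C)%N by apply: leq_trans CC; rewrite addnAC leq_addl.
have N0 : (0 < N)%N by move: big; case: (N).
have Nn : (N <= n)%N.
  have : (0 < #|{: A1}|)%N by rewrite -cardfE A1N.
  case/card_gt0P => a _; apply: leq_trans Sn; rewrite -A2N !cardfE -cardsT.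
  apply: (@leq_trans #|[set b : S | predT (val b)]|); last exact: max_card.
  apply: (@leq_card_fset_inj _ _ setT (fun b : A2 => val a + val b)).
    by move=> b b' _ _ /addrI/val_inj.
  by move=> b _; rewrite SE ?fsvalP.
have n0 : (0 < n)%N by apply: leq_trans Nn.
have n10 : (C * n ^ 10 < N ^ 11)%N.
  rewrite -(ltn_pmul2r N0) -expnSr; apply: leq_ltn_trans big.
  by rewrite [(n ^ 11)%N]expnSr mulnA leq_mul2l Nn orbT.
have n1 : (C * n < N ^ 2)%N.
  rewrite -(@ltn_pmul2r (N ^ 9)) ?expn_gt0 ?N0 // -expnD; apply: leq_ltn_trans n10.
  by rewrite -mulnA leq_mul2l [(n ^ 10)%N]expnS leq_mul2l leq_exp2r // Nn !orbT.
have N4 : (4 <= N)%N.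
  rewrite -(leq_exp2r _ _ (isT : 0 < 2)%N); apply: leq_trans (ltnW n1).
  apply: leq_trans (leq_mul c0 n0); exact: (isT : (4 ^ 2 <= 100 * 1)%N).
have [t1 [t2 base]] := exists_rich_base A10 A20 A1N A2N Y1N Y2N Sn T1n T2n SE T1E T2E N4.
set L := [fset pair_line q | q in base_pairs A1 A2 Y1 Y2 N n t1 t2]%fset.
have LN : (N ^ 4 <= 4 * n ^ 2 * #|` L|)%N.
  apply: (leq_trans base); have := card_base_lines Y1 Y2 N n A10 A20 t1 t2; rewrite -/L.
  move/(leq_mul (leqnn (2 * n ^ 2)%N))/leq_trans; apply.
  by rewrite mulnCA !mulnA.
(* The predecessor accounts for the point lost in [pair_line_rich]. *)
pose k := (N ^ 2 %/ (4 * n)).-1.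
have n4 : (0 < 4 * n)%N by rewrite muln_gt0.
have q0 : (25 <= N ^ 2 %/ (4 * n))%N.
  rewrite leq_divRL //; apply: leq_trans (ltnW n1).
  by rewrite mulnA leq_mul2r c0 orbT.
have k1 : (1 < k)%N by rewrite /k; lia.
have Nk : (N ^ 2 <= 8 * n * k)%N.
  have := ltn_ceil (N ^ 2) n4; rewrite -(ltn_predK q0) -/k => lt.
  apply: leq_trans (ltnW lt) _.
  rewrite [leqRHS](_ : _ = (2 * k) * (4 * n))%N; first by rewrite leq_mul2r; lia.
  by rewrite [LHS]mulnC -[in LHS](_ : 2 * 4 = 8)%N // !mulnA (mulnC 2 k) -!mulnA.
(* The least number of lines that contradicts [rich_lines_bound]. Keeping only [m0] of them ensures
   [864 * (n * m0) <= N ^ 3 <= p ^ 2]; if there are fewer than [m0], [LN] already gives the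
   claim. *)
pose m0 := (c1 * n ^ 9 %/ N ^ 8).+1.
have N8 : (0 < N ^ 8)%N by rewrite expn_gt0 N0.
have c1_0 : (0 < c1)%N by rewrite muln_gt0 e4E expn_gt0.
have [Lm|/exists_fsubset_card[L0 L0L L0m]] := ltnP #|` L| m0.
  move: big; rewrite ltnNge => /negP; apply.
  rewrite /m0 ltnS leq_divRL // in Lm.
  apply: (@leq_trans (2 * c * n ^ 11)); last by rewrite leq_mul2r C2 orbT.
  rewrite (_ : 12 = 4 + 8)%N // expnD; apply: (leq_trans (leq_mul LN (leqnn _))).
  rewrite -mulnA; apply: (leq_trans (leq_mul (leqnn _) Lm)).
  rewrite (_ : 11 = 2 + 9)%N // expnD /c.
  by rewrite mulnACA (mulnA 2 2 c1).
have m0N : (c1 * n ^ 9 < m0 * N ^ 8)%N by apply: ltn_ceil.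
have pm : (864 * (n * #|` L0|) <= p ^ 2)%N.
  rewrite L0m; apply: leq_trans Np.
  have m0N' : (m0 * N ^ 8 <= c * n ^ 9)%N.
    rewrite /m0 mulSn /c mul2n -addnn mulnDl; apply: leq_add; last exact: leq_trunc_div.
    apply: (@leq_trans (n ^ 9)%N); last by rewrite leq_pmull.
    apply: (@leq_trans (n ^ 8)%N); first by rewrite leq_exp2r.
    by rewrite [(n ^ 9)%N]expnS leq_pmull.
  have c_0 : (0 < c)%N by rewrite muln_gt0.
  rewrite -(leq_pmul2l c_0) -(leq_pmul2r N8) mulnA -[(c * N ^ 3 * _)%N]mulnA -expnD.
  apply: (@leq_trans (C * (n * m0) * N ^ 8)); first by rewrite !leq_mul2r (mulnC c) Cc !orbT.
  apply: (@leq_trans (c * (C * n ^ 10))); last by rewrite leq_mul2l (ltnW n10) orbT.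
  rewrite -(mulnA C) -(mulnA n) (mulnCA c C) leq_mul2l; apply/orP; right.
  by rewrite [(n ^ 10)%N]expnS (mulnCA c n) leq_mul2l m0N' orbT.
have le_n (t : F) (T : {fset F}) : (#|` T| <= n)%N -> (#|` inv_shift t T| <= n)%N.
  by apply: leq_trans; exact: leq_imfset_card.
have rich (l : L0) : (k <= #|[set x : inv_shift t1 T1 |
    line_at (val l) (val x) \in inv_shift t2 T2]|)%N.
  have /imfsetP[q /= qB ->] := fsubsetP L0L _ (fsvalP l).
  have := pair_line_rich A10 A20 T1E T2E qB.
  have : (N ^ 2 %/ (4 * n) <= sum_reps A1 A2 (pair_sum q))%N.
    move: qB; rewrite !inE => /andP[/andP[_ qr] _].
    by apply: leq_trans (leq_div2r (4 * n) qr) _; rewrite mulKn.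
  by rewrite /k => a b; have := leq_trans a b; rewrite addn1; case: (_ %/ _)%N.
have := C0P F p _ _ L0 n k charF (le_n t1 _ T1n) (le_n t2 _ T2n) k1 rich pm.
rewrite L0m leqNgt => /negP; apply.
apply: (@leq_ltn_trans (C0.+1 * n ^ 5)); first by rewrite leq_mul2r leqnSn orbT.
have n4' : (0 < e4 * n ^ 4)%N by rewrite muln_gt0 e4E !expn_gt0 n0.
rewrite -(ltn_pmul2r n4').
rewrite [ltnLHS](_ : _ = c1 * n ^ 9)%N; last first.
  by rewrite (_ : 9 = 5 + 4)%N // expnD /c1 mulnACA.
apply: (leq_trans m0N); rewrite -mulnA leq_mul2l; apply/orP; right.
rewrite e4E mulnC -!expnMn (_ : 8 = 2 * 4)%N // expnM leq_exp2r //.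
Qed.

(** * Ruzsa's inequality, real exponents and conclusion *)

Unset Implicit Arguments.

(** Fix a representation [a1 - a2] of each difference. The map from [(d, b)] to [(a1 + b, a2 + b)]
    is injective: subtraction recovers [d], then [b]. *)
Lemma ruzsa_triangle (F : fieldType) (A B : {fset F}) :
  (#|` sumset A [fset - a | a in A]%fset| * #|` B| <= #|` sumset A B| ^ 2)%N.
Proof.
set D := sumset A _; set S := sumset A B.
have rep (d : D) : exists q : F * F, [&& q.1 \in A, q.2 \in A & q.1 - q.2 == val d].
  have /imfset2P[a /= aA [_ /imfsetP[b /= bA ->] dE]] := fsvalP d.
  by exists (a, b); rewrite /= aA bA dE eqxx.
pose a1 d := (xchoose (rep d)).1; pose a2 d := (xchoose (rep d)).2.
have aE d : val d = a1 d - a2 d by have /and3P[_ _ /eqP <-] := xchooseP (rep d).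
have m1 (d : D) (b : B) : a1 d + val b \in S.
  by have /and3P[a1A _ _] := xchooseP (rep d); apply: in_imfset2 => //; apply: fsvalP.
have m2 (d : D) (b : B) : a2 d + val b \in S.
  by have /and3P[_ a2A _] := xchooseP (rep d); apply: in_imfset2 => //; apply: fsvalP.
pose f (t : D * B) : S * S := ([` m1 t.1 t.2], [` m2 t.1 t.2])%fset.
rewrite -mulnn !cardfE -!card_prod; apply: (leq_card f).
move=> [d b] [d' b'] /(congr1 (fun x => (val x.1, val x.2)))[/= e1 e2].
have dd : d = d'.
  apply: val_inj; rewrite !aE.
  have -> : a1 d - a2 d = (a1 d + val b) - (a2 d + val b) by ring.
  by rewrite e1 e2; ring.
by move: e1; rewrite dd => /addrI/val_inj->.
Qed.

(** Compare [l]-th powers; the successor of [C] makes the constant invertible and satisfies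
    [C <= C.+1 ^ l]. *)
Lemma powR_growth (R : realType) (N n C k l : nat) (s : R) :
  (0 < N)%N -> (0 < l)%N -> (N ^ k <= C * n ^ l)%N -> s * l%:R <= k%:R ->
  C.+1%:R^-1 * N%:R `^ s <= n%:R.
Proof.
move=> N0 l0 le sl; have C0 : 0 < C.+1%:R :> R by rewrite ltr0n.
rewrite ler_pdivrMl //.
have -> : (C.+1%:R * n%:R : R) = (C.+1 * n)%:R by rewrite natrM.
rewrite -(@ler_pXn2r _ l) ?nnegrE ?powR_ge0 ?ler0n //.
rewrite -powR_mulrn ?powR_ge0 // -powRrM.
apply: (@le_trans _ _ (N%:R `^ k%:R)); first by rewrite ler_powR // ler1n.
rewrite powR_mulrn ?ler0n // -!natrX ler_nat; apply: (leq_trans le).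
rewrite expnMn leq_mul2r; apply/orP; right.
by rewrite (leq_trans (leqnSn C)) // -(prednK l0) expnS leq_pmulr // expn_gt0.
Qed.

Lemma lt_powR_nat (R : realType) (N p k l : nat) : (0 < l)%N ->
  N%:R < p%:R `^ (k%:R / l%:R) :> R -> (N ^ l < p ^ k)%N.
Proof.
move=> l0 lt; rewrite -(ltr_nat R) !natrX -[X in _ < X]powR_mulrn ?ler0n //.
have -> : k%:R = k%:R / l%:R * l%:R :> R by rewrite divfK // pnatr_eq0 -lt0n.
by rewrite powRrM powR_mulrn ?powR_ge0 // ltr_pXn2r ?nnegrE ?powR_ge0 ?ler0n.
Qed.

Theorem proposition14 (R : realType) :
  exists c : R, 0 < c /\
    forall (F : fieldType) (p : nat) (A : {fset F}),
      p \in [pchar F] -> odd p ->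
      0 \notin A ->
      (1 < #|` A|)%N ->
      (#|` A|)%:R < p%:R `^ (5%:R / 8%:R) :> R ->
      c * (#|` A|)%:R `^ (16%:R / 15%:R)
        <= (#|` sumset A A| + #|` sumset (invset A) (invset A)|)%:R /\
      c * (#|` A|)%:R `^ (31%:R / 30%:R) <= (#|` sumset A (invset A)|)%:R.
Proof.
have [C growth] := inversion_growth.
exists (C.+1%:R^-1); split=> [|F p A charF _ A0 A1 Ap]; first by rewrite invr_gt0 ltr0n.
set N := #|` A| in A1 Ap *.
have N0 : (0 < N)%N by apply: ltnW.
(* From [N ^ 8 < p ^ 5] one gets [N ^ 15 <= N ^ 16 <= p ^ 10]. *)
have Np : (N ^ 3 <= p ^ 2)%N.
  have lt := @lt_powR_nat R N p 5 8 isT Ap.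
  rewrite -(@leq_exp2r _ _ 5) // -!expnM.
  apply: (@leq_trans (N ^ (8 * 2))); first by rewrite leq_exp2l.
  by rewrite (_ : 2 * 5 = 5 * 2)%N // [(N ^ _)%N]expnM [(p ^ _)%N]expnM leq_exp2r // ltnW.
have iN : #|` invset A| = N by rewrite card_imfset //; apply: invr_inj.
have inv_mem a : a \in A -> a^-1 \in invset A by move=> aA; apply/imfsetP; exists a.
split.
  set n := (_ + _)%N.
  have le : (N ^ 12 <= C * n ^ 11)%N.
    apply: (growth F p A A (invset A) (invset A) (sumset A A)
      (sumset (invset A) (invset A)) (sumset (invset A) (invset A))) => //.
    - exact: leq_addr.
    - exact: leq_addl.
    - exact: leq_addl.
    - by move=> a a' aA a'A; apply: in_imfset2.
    - by move=> y a yA aA; apply: in_imfset2 => //; apply: inv_mem.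
    - by move=> y a yA aA; apply: in_imfset2 => //; apply: inv_mem.
  (* Here [16 / 15 <= 12 / 11]. *)
  by apply: (@powR_growth R N n C 12 11 _ N0 isT le); lra.
set s := #|` _|.
have Ns : (N <= s)%N.
  have [a aA] : exists a, a \in A by apply/fset0Pn; rewrite -cardfs_gt0.
  have <- : #|` [fset (a + b)%R | b in invset A]%fset| = N.
    by rewrite card_imfset //; apply: addrI.
  by apply/fsubset_leq_card/fsubsetP => _ /imfsetP[b /= bA ->]; apply: in_imfset2.
pose NA := [fset - a | a in A]%fset.
have cNA : #|` NA| = N by rewrite card_imfset //; apply: oppr_inj.
have NA0 : 0 \notin NA.
  by apply: contraNN A0 => /imfsetP[a /= aA /eqP]; rewrite eq_sym oppr_eq0 => /eqP <-.
pose T2 := [fset - t | t in sumset A (invset A)]%fset.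
have ruz := ruzsa_triangle F A (invset A); rewrite iN -/s -/NA in ruz.
(* Ruzsa's bound for [A - A]; it also dominates [s], as [N <= s]. *)
pose n := (s ^ 2 %/ N)%N.
have le : (N ^ 12 <= C * n ^ 11)%N.
  apply: (growth F p A NA A NA (sumset A NA) (sumset A (invset A)) T2) => //.
  - by rewrite leq_divRL.
  - by rewrite leq_divRL // -mulnn leq_mul2l Ns orbT.
  - rewrite (leq_trans (leq_imfset_card _ _ _)) // leq_divRL // -mulnn leq_mul2l Ns orbT //.
  - by move=> a a' aA a'A; apply: in_imfset2.
  - by move=> y a yA aA; apply: in_imfset2 => //; apply: inv_mem.
  - move=> _ _ /imfsetP[y /= yA ->] /imfsetP[a /= aA ->].
    apply/imfsetP; exists (y + a^-1); first by apply: in_imfset2 => //; apply: inv_mem.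
    by rewrite invrN opprD.
(* Multiply by [N ^ 11] and use [n * N <= s ^ 2]; then [31 / 30 <= 23 / 22] suffices. *)
have le2 : (N ^ 23 <= C * s ^ 22)%N.
  have nN : (n * N <= s ^ 2)%N by apply: leq_trunc_div.
  rewrite (_ : 23 = 12 + 11)%N // expnD (leq_trans (leq_mul le (leqnn _))) //.
  rewrite -mulnA leq_mul2l -expnMn (_ : 22 = 2 * 11)%N // expnM leq_exp2r //.
  by rewrite nN orbT.
by apply: (@powR_growth R N s C 23 22 _ N0 isT le2); lra.
Qed.
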